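(* Let $(A, [-,-], \rho, g, L)$ be a Carrollian Lie algebroid over a smooth manifold $M$. Then there exists a Carrollian connection on $A$, i.e., a Lie algebroid connection $\nabla$ on $A$ that is both $L$-compatible and metric compatible.
   Context: Manifolds are finite-dimensional, second-countable, Hausdorff and smooth; $\mathrm{Sec}(A)$ denotes the smooth global sections of a vector bundle $A\to M$. A Lie algebroid $(A,[-,-],\rho)$ is a vector bundle $A\to M$ with a Lie bracket $[-,-]$ on $\mathrm{Sec}(A)$ and an anchor $\rho$ (a vector bundle map $A\to TM$ over the identity, written on sections as $u\mapsto \rho_u\in \mathrm{Vect}(M)$) such that $[u,fv]=\rho_u(f)v+f[u,v]$ for $u,v\in\mathrm{Sec}(A)$, $f\in C^\infty(M)$. A (possibly degenerate) metric on $A$ is a symmetric $C^\infty(M)$-bilinear map $g:\mathrm{Sec}(A)\times\mathrm{Sec}(A)\to C^\infty(M)$ (no signature condition is imposed). A Carrollian Lie algebroid $(A,[-,-],\rho,g,L)$ is a Lie algebroid $(A,[-,-],\rho)$ with a degenerate metric $g$ and a trivial line bundle $L\to M$ that is a vector subbundle $L\subset A$, such that $\ker(g):=\{u\in\mathrm{Sec}(A) : g(u,v)=0 \text{ for all } v\in\mathrm{Sec}(A)\}=\mathrm{Sec}(L)$, the kernel of $g$ having constant rank: at every $m\in M$ the kernel of the bilinear form $g_m$ on $A_m$ is $L_m$. A Lie algebroid connection on $A$ is an $\mathbb{R}$-bilinear map $\nabla:\mathrm{Sec}(A)\times\mathrm{Sec}(A)\to\mathrm{Sec}(A)$ with $\nabla_{fu}v=f\nabla_uv$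 and $\nabla_u(fv)=f\nabla_uv+\rho_u(f)v$. It is $L$-compatible if $\nabla_uv\in\mathrm{Sec}(L)$ for all $u\in\mathrm{Sec}(A)$, $v\in\mathrm{Sec}(L)$. It is metric compatible if $\rho_u(g(v,w))=g(\nabla_uv,w)+g(v,\nabla_uw)$ for all $u,v,w\in\mathrm{Sec}(A)$. It is Carrollian if it is both. *)

(* Defs.v *)
From HB Require Import structures.
From mathcomp Require Import all_boot all_order all_algebra.
From mathcomp Require Import all_classical all_reals all_analysis.

Set Implicit Arguments.
Unset Strict Implicit.
Unset Printing Implicit Defensive.

Import Order.TTheory GRing.Theory Num.Theory.
Import numFieldNormedType.Exports.

Local Open Scope classical_set_scope.
Local Open Scope ring_scope.

(* [Ck k O f]: f is of class C^k on the open set O.  The differential of f    *)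
(* is C^k as a map into linear maps iff all the 'D_v f are C^k (the domains   *)
(* used below are finite-dimensional).                                        *)
Fixpoint Ck (R : realType) (V W : normedModType R) (k : nat) (O : set V)
    (f : V -> W) : Prop :=
  match k with
  | 0%N => forall x, O x -> {for x, continuous f}
  | k'.+1 => (forall x, O x -> differentiable f x) /\
             (forall v, Ck k' O (fun x => 'D_v f x))
  end.

Definition Cinfty (R : realType) (V W : normedModType R) (O : set V)
  (f : V -> W) : Prop := forall k, Ck k O f.

Section Calculus.
Variable R : realType.

Lemma near_eq_diff (V W : normedModType R) (f g : V -> W) (x : V) :
  (\near x, f x = g x) -> differentiable f x ->
  differentiable g x /\ ('d g x = 'd f x :> (V -> W)).
Proof.
move=> fg df.
have gE : g \o shift x = cst (g x) + 'd f x +o_ 0 id.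
  apply/eqaddoP => e e0.
  have /diff_locally /eqaddoP /(_ e e0) dfx := df.
  have fgx := nbhs_singleton fg.
  have fg0 : \forall h \near 0, f (h + x) = g (h + x).
    move: fg; rewrite (near_shift 0) subr0.
    by apply: filterS => h; rewrite /=.
  apply: filterS2 dfx fg0 => h; rewrite /= !fctE /= => + <-.
  by rewrite fgx.
have dg := diff_unique (diff_continuous df) gE.
split; last exact: dg.
apply/diff_locallyP; rewrite dg; split; last exact: gE.
exact: diff_continuous.
Qed.


Lemma diff_comp_near (U V W : normedModType R) (f : U -> V) (g : V -> W)
    (h : U -> W) (x v : U) (y : V) : f x = y ->
  differentiable f x -> differentiable g y -> (\near x, (g \o f) x = h x) ->
  'd g y ('d f x v) = 'd h x v.
Proof.
move=> <- df dg ngfh.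
have [_ ->] := near_eq_diff ngfh (differentiable_comp df dg).
by rewrite (diff_comp df dg).
Qed.

Lemma Ck_sub (V W : normedModType R) k (U O : set V) (f : V -> W) :
  U `<=` O -> Ck k O f -> Ck k U f.
Proof.
move=> UO; elim: k f => [|k IH] f /=; first by move=> cf x /UO; exact: cf.
by move=> [df dkf]; split=> [x /UO /df //|v]; apply: IH.
Qed.

Section Ck.
Variables (V : normedModType R) (O : set V).
Hypothesis oO : open O.
Implicit Types W : normedModType R.

Lemma Ck_ext W k (f g : V -> W) :
  (forall x, O x -> f x = g x) -> Ck k O f -> Ck k O g.
Proof.
elim: k f g => [|k IH] f g fg /=.
  move=> cf x Ox; have fgx : {near x, f =1 g}.
    by apply: filterS (open_nbhs_nbhs (conj oO Ox)).
  rewrite /prop_for /continuous_at -(fg x Ox); apply: cvg_trans (cf x Ox).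
  exact: near_eq_cvg.
case=> df dk; split=> [x Ox|v].
  apply: (near_eq_diff _ (df x Ox)).1.
  exact: filterS (open_nbhs_nbhs (conj oO Ox)).
apply: IH (dk v) => x Ox; apply: near_eq_derive.
exact: filterS (open_nbhs_nbhs (conj oO Ox)).
Qed.

Lemma CkS W k (f : V -> W) : Ck k.+1 O f -> Ck k O f.
Proof.
elim: k f => [|k IH] f [df dk].
  by move=> x Ox; apply: differentiable_continuous; exact: df.
by split=> // v; apply: IH; exact: dk.
Qed.

Lemma Ck_cst W k (a : W) : Ck k O (fun=> a).
Proof.
elim: k a => [|k IH] a /=; first by move=> x _; exact: cst_continuous.
split=> [x _|v]; first exact: differentiable_cst.
by apply: Ck_ext (IH 0) => x _; rewrite derive_cst.
Qed.

Lemma CkD W k (f g : V -> W) :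
  Ck k O f -> Ck k O g -> Ck k O (fun x => f x + g x).
Proof.
elim: k f g => [|k IH] f g /=.
  by move=> cf cg x Ox; apply: continuousD; [exact: cf|exact: cg].
move=> [df dkf] [dg dkg]; split=> [x Ox|v].
  by apply: differentiableD; [exact: df|exact: dg].
apply: Ck_ext (IH _ _ (dkf v) (dkg v)) => x Ox.
by rewrite [RHS](deriveD (diff_derivable (df x Ox)) (diff_derivable (dg x Ox))).
Qed.

Lemma Ck_sum W k (I : Type) (r : seq I) (f : I -> V -> W) :
  (forall i, Ck k O (f i)) -> Ck k O (fun x => \sum_(i <- r) f i x).
Proof.
move=> fk; elim: r => [|i r IH].
  by apply: Ck_ext (Ck_cst k 0) => x _; rewrite big_nil.
by apply: Ck_ext (CkD (fk i) IH) => x _; rewrite big_cons.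
Qed.

Lemma CkM k (f g : V -> R) :
  Ck k O f -> Ck k O g -> Ck k O (fun x => f x * g x).
Proof.
elim: k f g => [|k IH] f g.
  by move=> cf cg x Ox; apply: continuousM; [exact: cf|exact: cg].
move=> Cf Cg; have [df dkf] := Cf; have [dg dkg] := Cg.
split=> [x Ox|v]; first by apply: differentiableM; [exact: df|exact: dg].
apply: Ck_ext (CkD (IH _ _ (CkS Cf) (dkg v)) (IH _ _ (CkS Cg) (dkf v))) => x Ox.
by rewrite [RHS](deriveM (diff_derivable (df x Ox)) (diff_derivable (dg x Ox))).
Qed.

Lemma CkZl W k (f : V -> R) (w : W) :
  Ck k O f -> Ck k O (fun x => f x *: w).
Proof.
elim: k f => [|k IH] f.
  move=> cf x Ox; apply: (@continuous_comp _ _ _ f ( *:%R ^~ w)).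
    exact: cf.
  exact: scalel_continuous.
move=> [df dkf]; split=> [x Ox|v].
  by apply: differentiableZl; exact: df.
apply: Ck_ext (IH _ (dkf v)) => x Ox.
have dfx := df x Ox.
by rewrite !deriveE ?diffZl //; exact: differentiableZl.
Qed.

Lemma Ck_coord m n k (f : V -> 'M[R]_(m, n)) i j :
  Ck k O f -> Ck k O (fun x => f x i j).
Proof.
elim: k f => [|k IH] f.
  move=> cf x Ox; apply: (@continuous_comp _ _ _ f (fun N => N i j)).
    exact: cf.
  exact: coord_continuous.
move=> [df dkf]; split=> [x Ox|v].
  apply: (@differentiable_comp _ _ _ _ f (fun N => N i j)); first exact: df.
  exact: differentiable_coord.
apply: Ck_ext (IH _ (dkf v)) => x Ox.
by rewrite derive_mx ?mxE //; apply: diff_derivable; exact: df.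
Qed.

Lemma Ck_row n k (f : V -> 'rV[R]_n) :
  (forall j, Ck k O (fun x => f x 0 j)) -> Ck k O f.
Proof.
move=> fk.
apply: Ck_ext (Ck_sum (index_enum 'I_n) (fun j => CkZl (delta_mx 0 j) (fk j))).
by move=> x _; rewrite -row_sum_delta.
Qed.

End Ck.

Lemma diff_rowE (W : normedModType R) m (f : 'rV[R]_m -> W) x v :
  'd f x v = \sum_i v 0 i *: 'd f x (delta_mx 0 i).
Proof.
by rewrite {1}(row_sum_delta v) linear_sum; apply: eq_bigr => i _; rewrite linearZ.
Qed.

Lemma Ck_comp m n k (U : set 'rV[R]_m) (O : set 'rV[R]_n)
    (h : 'rV[R]_m -> 'rV[R]_n) p (f : 'rV[R]_n -> 'rV[R]_p) :
  open U -> open O -> (forall x, U x -> O (h x)) ->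
  Ck k U h -> Ck k O f -> Ck k U (f \o h).
Proof.
move=> oU oO UO Ch Cf; apply: Ck_row => // j.
suff {f Cf} CkRcomp (g : 'rV[R]_n -> R) : Ck k O g -> Ck k U (g \o h).
  exact: CkRcomp (Ck_coord oO 0 j Cf).
elim: k g h UO Ch => [|k IH] g h UO Ch Cg.
  by move=> x Ux; apply: continuous_comp; [exact: Ch|apply: Cg; exact: UO].
have [dh dkh] := Ch; have [dg dkg] := Cg.
split=> [x Ux|v].
  by apply: differentiable_comp; [exact: dh|apply: dg; exact: UO].
apply: Ck_ext (Ck_sum oU (index_enum 'I_n) (fun i => CkM oU
  (Ck_coord oU 0 i (dkh v)) (IH _ _ UO (CkS Ch) (dkg (delta_mx 0 i)))))
  => // x Ux.
have dhx := dh x Ux; have dgx := dg _ (UO x Ux).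
rewrite [RHS]deriveE; last exact: differentiable_comp.
rewrite diff_comp // [RHS]diff_rowE; apply: eq_bigr => i _ /=.
by rewrite !deriveE.
Qed.

End Calculus.

Record chart (R : realType) (T : topologicalType) (n : nat) := Chart {
  cdom : set T;
  cmap : T -> 'rV[R]_n;
  cinv : 'rV[R]_n -> T;
  cdom_open : open cdom;
  cimg_open : open (cmap @` cdom);
  cmap_continuous : forall m, cdom m -> {for m, continuous cmap};
  cinv_continuous : forall y, (cmap @` cdom) y -> {for y, continuous cinv};
  cmapK : forall m, cdom m -> cinv (cmap m) = m }.

Definition transition (R : realType) (T : topologicalType) (n : nat)
    (c c' : chart R T n) : 'rV[R]_n -> 'rV[R]_n :=
  cmap c' \o cinv c.

Record manifold (R : realType) := Manifold {
  mcarrier :> topologicalType;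
  mdim : nat;
  midx : Type;
  mchart : midx -> chart R mcarrier mdim;
  mcover : forall m, exists i, cdom (mchart i) m;
  mcompat : forall i j,
    Cinfty (cmap (mchart i) @` (cdom (mchart i) `&` cdom (mchart j)))
           (transition (mchart i) (mchart j));
  mhausdorff : hausdorff_space mcarrier;
  msecond_countable : @second_countable mcarrier }.

Lemma chart_image_open (R : realType) (M : manifold R) (i : midx M) (O : set M) : open O ->
  open (cmap (mchart i) @` (cdom (mchart i) `&` O)).
Proof.
move=> oO; set c := mchart i.
rewrite openE => _ [m [Um Om] <-].
have img : (cmap c @` cdom c) (cmap c m) by exists m.
have nO : \forall y \near cmap c m, O (cinv c y).
  apply: (cinv_continuous img); rewrite cmapK //.
  exact: open_nbhs_nbhs.
have nU := open_nbhs_nbhs (conj (@cimg_open _ _ _ c) img).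
rewrite /interior /=; apply: filterS2 nU nO => _ [p Up <-].
by rewrite cmapK // => Op; exists p.
Qed.

(* [smooth_on O f]: f is smooth on the open subset O of M; by compatibility   *)
(* of the charts it would suffice to test charts covering O.                  *)
Definition smooth_on (R : realType) (M : manifold R) (W : normedModType R)
    (O : set M) (f : M -> W) : Prop :=
  forall i, Cinfty (cmap (mchart i) @` (cdom (mchart i) `&` O))
                   (f \o cinv (mchart i)).

Definition smooth (R : realType) (M : manifold R) (f : M -> R) : Prop :=
  smooth_on setT f.

(* A local trivialization of the family E of vector spaces over the open set  *)
(* tdom: [tcoord m] identifies E m with R^r, with inverse [tframe m].         *)
Record trivialization (R : realType) (M : manifold R) (E : M -> lmodType R)
    (r : nat) := Trivialization {
  tdom : set M;
  tcoord : forall m, {linear E m -> 'rV[R]_r};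
  tframe : forall m, 'rV[R]_r -> E m;
  tdom_open : open tdom;
  tcoordK : forall m, tdom m -> cancel (tcoord m) (tframe m);
  tframeK : forall m, tdom m -> cancel (tframe m) (tcoord m) }.

(* The change of trivialization from t to t' is smooth.                       *)
Definition smooth_change (R : realType) (M : manifold R) (E : M -> lmodType R)
    (r : nat) (t t' : trivialization E r) : Prop :=
  forall x, smooth_on (tdom t `&` tdom t') (fun m => tcoord t' m (tframe t m x)).

(* A vector bundle is given by its fibres and a smooth vector bundle atlas.   *)
Record vector_bundle (R : realType) (M : manifold R) := VectorBundle {
  fibre : M -> lmodType R;
  rank : nat;
  vidx : Type;
  vtriv : vidx -> trivialization fibre rank;
  vcover : forall m, exists i, tdom (vtriv i) m;
  vcompat : forall i j, smooth_change (vtriv i) (vtriv j) }.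

(* Not necessarily smooth sections; the smooth ones form [Sec A].             *)
Definition section (R : realType) (M : manifold R) (A : vector_bundle M) :=
  forall m : M, fibre A m.

Definition Sec (R : realType) (M : manifold R) (A : vector_bundle M) :
    set (section A) :=
  [set u | forall i : vidx A,
    smooth_on (tdom (vtriv i)) (fun m => tcoord (vtriv i) m (u m))].

Arguments Sec {R M} A _.

(* Vector bundle maps over the identity of M.                                 *)
Record bundle_map (R : realType) (M : manifold R) (A B : vector_bundle M) :=
  BundleMap {
    bmap :> forall m, {linear fibre A m -> fibre B m};
    bmap_smooth : forall (i : vidx A) (j : vidx B) x,
      smooth_on (tdom (vtriv i) `&` tdom (vtriv j))
        (fun m => tcoord (vtriv j) m (bmap m (tframe (vtriv i) m x))) }.

Section ProductBundle.
Variables (R : realType) (M : manifold R) (k : nat).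

Definition product_fibre (m : M) : lmodType R := 'rV[R]_k.

Definition product_triv : trivialization product_fibre k :=
  @Trivialization R M product_fibre k setT (fun=> idfun) (fun=> idfun) openT
    (fun _ _ _ => erefl) (fun _ _ _ => erefl).

Fact product_cover (m : M) : exists i : unit, tdom product_triv m.
Proof. by exists tt. Qed.

Fact product_compat (i j : unit) : smooth_change product_triv product_triv.
Proof.
move=> x l k'; apply: Ck_cst.
by apply: chart_image_open; rewrite setIT; exact: openT.
Qed.

Definition product_bundle : vector_bundle M :=
  VectorBundle product_cover product_compat.

End ProductBundle.

Section TangentBundle.
Variables (R : realType) (M : manifold R).
Implicit Types (i j l : midx M) (m : M).

Definition chart_at (m : M) : midx M := projT1 (cid (mcover m)).

Lemma chart_atP m : cdom (mchart (chart_at m)) m.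
Proof. exact: projT2 (cid (mcover m)). Qed.

(* A tangent vector at m is represented by its components in the chart        *)
(* [chart_at m]; its components in another chart around m are obtained by     *)
(* applying the differential of the transition map.                           *)
Definition tangent_space (m : M) : lmodType R := 'rV[R]_(mdim M).

Local Notation dom i := (cdom (mchart i)).
Local Notation phi i := (cmap (mchart i)).
Local Notation psi i := (cinv (mchart i)).

Definition tangent_coord (i : midx M) (m : M) :
    {linear tangent_space m -> 'rV[R]_(mdim M)} :=
  'd (transition (mchart (chart_at m)) (mchart i)) (phi (chart_at m) m).

Definition tangent_frame (i : midx M) (m : M) :
    'rV[R]_(mdim M) -> tangent_space m :=
  'd (transition (mchart i) (mchart (chart_at m))) (phi i m).

Lemma near_chart i j m : dom i m -> dom j m ->
  \forall y \near phi i m, (phi i @` (dom i `&` dom j)) y.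
Proof.
move=> mi mj; apply: open_nbhs_nbhs; split; last by exists m.
exact/chart_image_open/cdom_open.
Qed.

Lemma transition_differentiable i j m : dom i m -> dom j m ->
  differentiable (transition (mchart i) (mchart j)) (phi i m).
Proof. by move=> mi mj; apply: (mcompat i j 1%N).1; exists m. Qed.

Lemma transition_cocycle i j l m x : dom i m -> dom j m -> dom l m ->
  'd (transition (mchart j) (mchart l)) (phi j m)
    ('d (transition (mchart i) (mchart j)) (phi i m) x) =
  'd (transition (mchart i) (mchart l)) (phi i m) x.
Proof.
move=> mi mj ml.
apply: diff_comp_near.
- by rewrite /transition /= cmapK.
- exact: transition_differentiable.
- exact: transition_differentiable.
- apply: filterS (near_chart mi mj) => _ [p [pi pj] <-].
  by rewrite /transition /= !cmapK.
Qed.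

Lemma transition_diff_id i m x : dom i m ->
  'd (transition (mchart i) (mchart i)) (phi i m) x = x.
Proof.
move=> mi.
have tE : \forall y \near phi i m, id y = transition (mchart i) (mchart i) y.
  apply: filterS (near_chart mi mi) => _ [p [pi _] <-].
  by rewrite /transition /= !cmapK.
have [//|_ ->] := near_eq_diff tE.
by rewrite diff_val.
Qed.

Fact tangent_coordK i m : dom i m ->
  cancel (tangent_coord i m) (tangent_frame i m).
Proof.
move=> mi x; have mc := chart_atP m; rewrite /tangent_frame /tangent_coord.
by rewrite [LHS]transition_cocycle // transition_diff_id.
Qed.

Fact tangent_frameK i m : dom i m ->
  cancel (tangent_frame i m) (tangent_coord i m).
Proof.
move=> mi x; have mc := chart_atP m; rewrite /tangent_frame /tangent_coord.
by rewrite transition_cocycle // transition_diff_id.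
Qed.

Definition tangent_triv i : trivialization tangent_space (mdim M) :=
  Trivialization (cdom_open (mchart i)) (@tangent_coordK i) (@tangent_frameK i).

Fact tangent_cover m : exists i, tdom (tangent_triv i) m.
Proof. exact: mcover. Qed.

Fact tangent_compat i j : smooth_change (tangent_triv i) (tangent_triv j).
Proof.
move=> x l k; change (Ck k (phi l @` (dom l `&` (dom i `&` dom j)))
  ((fun m => tangent_coord j m (tangent_frame i m x)) \o psi l)).
have oU : open (dom i `&` dom j) by apply: openI; exact: cdom_open.
have oW := @chart_image_open R M l _ oU.
have oO := @chart_image_open R M i (dom j) (cdom_open _).
have Cli : Ck k (phi l @` (dom l `&` (dom i `&` dom j)))
    (transition (mchart l) (mchart i)).
  by apply: Ck_sub (mcompat l i k) => _ [m [ml [mi mj]] <-]; exists m.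
have H := Ck_comp oW oO _ Cli ((mcompat i j k.+1).2 x).
refine (Ck_ext oW _ (H _)).
- move=> _ [m [ml [mi mj]] <-]; have mc := chart_atP m.
  rewrite /transition /= cmapK // /tangent_coord /tangent_frame.
  rewrite deriveE; last exact: transition_differentiable.
  by rewrite [RHS]transition_cocycle.
- move=> _ [m [ml [mi mj]] <-]; exists m => //.
  by rewrite /transition /= cmapK.
Qed.

Definition tangent_bundle : vector_bundle M :=
  VectorBundle tangent_cover tangent_compat.

(* The derivative v(f) of f along a tangent vector v at m.                    *)
Definition tangent_derive (m : M) (v : fibre tangent_bundle m) (f : M -> R) : R :=
  'D_v (f \o psi (chart_at m)) (phi (chart_at m) m).

End TangentBundle.

Section Subbundle.
Variables (R : realType) (M : manifold R) (A : vector_bundle M).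
Implicit Types L : forall m : M, set (fibre A m).

(* L is a vector subbundle of A of rank k: around each point there is a       *)
(* trivialization of A that takes L to the subspace R^k x 0 of R^r.           *)
Definition is_subbundle (k : nat) L : Prop :=
  (k <= rank A)%N /\
  forall m0, exists t : trivialization (fibre A) (rank A),
    [/\ tdom t m0,
        forall i : vidx A, smooth_change t (vtriv i) /\ smooth_change (vtriv i) t
      & forall m, tdom t m -> L m =
          [set e | forall a : 'I_(rank A), (k <= a)%N -> tcoord t m e 0 a = 0]].

(* L is isomorphic to the product bundle M x R^k.                             *)
Definition is_trivial (k : nat) L : Prop :=
  exists Phi : bundle_map (product_bundle M k) A,
    forall m, injective (Phi m) /\ range (Phi m) = L m.

Definition trivial_line_subbundle L : Prop :=
  is_subbundle 1 L /\ is_trivial 1 L.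

Definition SecL L : set (section A) :=
  [set u | Sec A u /\ forall m, L m (u m)].

End Subbundle.

Section BilinearOperations.
Variables (R : realType) (M : manifold R) (A : vector_bundle M).

(* Operations on Sec A are represented by functions on all sections; they     *)
(* are only constrained, and only used, on Sec A.                             *)
Record Rbilinear (B : section A -> section A -> section A) : Prop := {
  Rbil_Sec : forall u v, Sec A u -> Sec A v -> Sec A (B u v);
  Rbil_l : forall (a : R) u u' v, Sec A u -> Sec A u' -> Sec A v ->
    forall m, B (fun p => a *: u p + u' p) v m = a *: B u v m + B u' v m;
  Rbil_r : forall (a : R) u v v', Sec A u -> Sec A v -> Sec A v' ->
    forall m, B u (fun p => a *: v p + v' p) m = a *: B u v m + B u v' m }.

Record lie_bracket (br : section A -> section A -> section A) : Prop := {
  br_bilinear : Rbilinear br;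
  br_alternating : forall u, Sec A u -> forall m, br u u m = 0;
  br_jacobi : forall u v w, Sec A u -> Sec A v -> Sec A w -> forall m,
    br u (br v w) m + br v (br w u) m + br w (br u v) m = 0 }.

Record is_metric (g : section A -> section A -> M -> R) : Prop := {
  g_smooth : forall u v, Sec A u -> Sec A v -> smooth (g u v);
  g_sym : forall u v, Sec A u -> Sec A v -> forall m, g u v m = g v u m;
  g_linear : forall (f : M -> R) u u' v, smooth f ->
    Sec A u -> Sec A u' -> Sec A v ->
    forall m, g (fun p => f p *: u p + u' p) v m = f m * g u v m + g u' v m }.

Variable g : section A -> section A -> M -> R.

Definition metric_ker : set (section A) :=
  [set u | Sec A u /\ forall v, Sec A v -> forall m, g u v m = 0].

(* The kernel of the bilinear form g_m on the fibre at m, which is given by   *)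
(* g_m (u m) (v m) = g u v m for u and v in Sec A.                            *)
Definition metric_ker_at (m : M) : set (fibre A m) :=
  [set x | forall u v, Sec A u -> Sec A v -> u m = x -> g u v m = 0].

End BilinearOperations.

Record lie_algebroid (R : realType) (M : manifold R) := LieAlgebroid {
  la_bundle :> vector_bundle M;
  la_br : section la_bundle -> section la_bundle -> section la_bundle;
  la_anchor : bundle_map la_bundle (tangent_bundle M);
  la_br_lie : lie_bracket la_br;
  la_leibniz : forall (f : M -> R) u v, smooth f ->
    Sec la_bundle u -> Sec la_bundle v -> forall m,
    la_br u (fun p => f p *: v p) m =
      tangent_derive (la_anchor m (u m)) f *: v m + f m *: la_br u v m }.

(* rho_u(f) *)
Definition anchor_derive (R : realType) (M : manifold R) (A : lie_algebroid M)
    (u : section A) (f : M -> R) : M -> R :=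
  fun m => tangent_derive (la_anchor A m (u m)) f.

Record carrollian_lie_algebroid (R : realType) (M : manifold R) :=
  CarrollianLieAlgebroid {
    ca_algebroid :> lie_algebroid M;
    ca_metric : section ca_algebroid -> section ca_algebroid -> M -> R;
    ca_line : forall m, set (fibre ca_algebroid m);
    ca_metricP : is_metric ca_metric;
    ca_lineP : trivial_line_subbundle ca_line;
    ca_kerE : metric_ker ca_metric = SecL ca_line;
    ca_ker_atE : forall m (x : fibre ca_algebroid m),
      metric_ker_at ca_metric x <-> ca_line x }.

Section Connections.
Variables (R : realType) (M : manifold R).

Record is_connection (A : lie_algebroid M)
    (nabla : section A -> section A -> section A) : Prop := {
  nabla_bilinear : Rbilinear nabla;
  nabla_tensorial : forall (f : M -> R) u v, smooth f -> Sec A u -> Sec A v ->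
    forall m, nabla (fun p => f p *: u p) v m = f m *: nabla u v m;
  nabla_leibniz : forall (f : M -> R) u v, smooth f -> Sec A u -> Sec A v ->
    forall m, nabla u (fun p => f p *: v p) m =
      f m *: nabla u v m + anchor_derive u f m *: v m }.

Variable A : carrollian_lie_algebroid M.
Variable nabla : section A -> section A -> section A.
Local Notation g := (@ca_metric R M A).
Local Notation L := (@ca_line R M A).

Definition L_compatible : Prop :=
  forall u v, Sec A u -> SecL L v -> SecL L (nabla u v).

Definition metric_compatible : Prop :=
  forall u v w, Sec A u -> Sec A v -> Sec A w -> forall m,
    anchor_derive u (g v w) m = g (nabla u v) w m + g v (nabla u w) m.

Definition carrollian_connection : Prop :=
  [/\ is_connection nabla, L_compatible & metric_compatible].

End Connections.

(* Main.v *)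
(* Proof idea.  Call N a weighted Carrollian connection of weight f if it     *)
(* satisfies the axioms of a Carrollian connection with f rho_u in place of   *)
(* rho_u.  These objects form a module over the smooth functions, so that a   *)
(* partition of unity glues weighted connections whose weights are 1 on the   *)
(* members of an open cover into one of weight 1.                             *)
(* Locally, take a frame e_a of A with e_0 spanning L.  The flat connection D *)
(* of the frame preserves L, and the defect                                   *)
(*   Q_u(v,w) = rho_u(g(v,w)) - g(D_u v, w) - g(v, D_u w)                     *)
(* is symmetric, C^oo-bilinear and zero when v or w is in L.  It is therefore *)
(* a form on A / L, where g is nondegenerate, and raising its second index    *)
(* with g yields an L-compatible metric connection D_u + Q_u^# / 2.           *)
(* The cover is countable by second countability.  If f_k = 1 on its k-th     *)
(* member, the functions f_k prod_(j<k) (1 - f_j) form a locally finite       *)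
(* partition of unity, without any use of paracompactness.                    *)

(* The axioms of a weighted Carrollian connection are linear in the pair (weight, operator).
   Combinations over the smooth functions therefore stay in the class, and only weight 1 near a
   given point has to be reached: [local_to_global], which rests on [glued_connection].

   Near a point, the flat connection D of an adapted frame preserves L but has a metric defect Q. As
   L is the kernel of g and D preserves L, Q vanishes on L; on A / L the constant rank condition
   makes g invertible, so Q_u(v, w) = g(T_u v, w) for some tensorial T. By symmetry of Q, half of T
   added to D removes the defect, and T_u kills L, so L-compatibility survives: [metric_corrected]
   and [corrected_weighted].

   Operators act on global sections, so local data are cut off rather than restricted. Frame and
   coordinates both carry a factor c, which gives D the weight chi = c^2. The final weight b lives
   where c = 1, whence b chi = b. [exists_adapted_frame] builds these data and obtains the dual
   frame from an inverted Gram matrix. *)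
Require Import Defs.
From mathcomp Require Import all_boot all_order all_algebra.
From mathcomp Require Import all_classical all_reals all_analysis.
From mathcomp Require Import ring lra.

Set Implicit Arguments.
Unset Strict Implicit.
Unset Printing Implicit Defensive.

Import Order.TTheory GRing.Theory Num.Theory.
Import numFieldNormedType.Exports.

Local Open Scope classical_set_scope.
Local Open Scope ring_scope.

(** * C^k functions and a plateau function *)

Section CkExtra.
Variables (R : realType) (V : normedModType R).
Implicit Types (W : normedModType R) (O : set V).

(** The functions are total and [Ck] constrains their derivatives pointwise, so U need not be
    open. *)
Lemma Ck_local W k O (f : V -> W) :
  (forall x, O x -> exists2 U : set V, U x & Ck k U f) -> Ck k O f.
Proof.
elim: k f => [|k IH] f loc /=.
  move=> x Ox; have [U Ux cf] := loc x Ox. exact: (cf x Ux).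
split=> [x /loc[U Ux [df _]]|v]; first exact: df.
by apply: IH => x /loc[U Ux [_ dkf]]; exists U => //; exact: dkf.
Qed.

Variable O : set V.
Hypothesis oO : open O.

Lemma CkV k (f : V -> R) : (forall x, O x -> f x != 0) ->
  Ck k O f -> Ck k O (fun x => (f x)^-1).
Proof.
move=> f0; elim: k => [|k IH] Cf.
  by move=> x Ox; apply: continuousV; [exact: f0|exact: Cf].
have [df dkf] := Cf.
split=> [x Ox|v]; first by apply: differentiableV; [exact: df|exact: f0].
have CV := IH (CkS Cf).
have H := CkM oO (CkM oO (CkM oO CV CV) (dkf v)) (Ck_cst oO k (-1 : R)).
apply: (Ck_ext oO _ H) => x Ox.
rewrite deriveV; [|exact: f0|exact: diff_derivable (df x Ox)].
by rewrite mulrN1 -invfM -expr2 scaleNr.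
Qed.

Lemma derive_compR (F : R -> R) (f : V -> R) x v F' :
  is_derive (f x) 1 F F' -> differentiable f x ->
  differentiable (F \o f) x /\ 'D_v (F \o f) x = F' * 'D_v f x.
Proof.
move=> [dF <-] df; have /derivable1_diffP dF1 := dF.
have dFf : differentiable (F \o f) x by exact: differentiable_comp.
split=> //; rewrite !deriveE // diff_comp //= diff1E //= derive1E.
by rewrite scale1r; exact: mulrC.
Qed.

End CkExtra.

(** * A smooth plateau from exp(-1/x) *)

Section Flat.
Variable R : realType.

(* [flat 0] is the function exp(-1/x) extended by 0 to x <= 0; the powers     *)
(* x^-n make the family stable under differentiation.                         *)
Definition flat (n : nat) (x : R) : R :=
  if x <= 0 then 0 else x^-1 ^+ n * expR (- x^-1).

Lemma flat_le0 n x : x <= 0 -> flat n x = 0.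
Proof. by rewrite /flat => ->. Qed.

Lemma flatE n x : 0 < x -> flat n x = x^-1 ^+ n * expR (- x^-1).
Proof. by move=> x0; rewrite /flat leNgt x0. Qed.

Lemma flat_gt0 n x : 0 < x -> 0 < flat n x.
Proof.
move=> x0; rewrite flatE //.
by rewrite mulr_gt0 ?expR_gt0 // exprn_gt0 // invr_gt0.
Qed.

Lemma flat_ge0 n x : 0 <= flat n x.
Proof.
by have [/flat_le0->//|/(flat_gt0 n)/ltW] := leP x 0.
Qed.

(** With y = 1/x this is y^(n+2) <= (n+2)! exp(y), one term of the exponential series. The quadratic
    bound makes the derivative at 0 vanish. *)
Lemma flat_le_sqr n x : flat n x <= (n.+2)`!%:R * x ^+ 2.
Proof.
have [x0|x0] := leP x 0.
  by rewrite flat_le0 // mulr_ge0 // sqr_ge0.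
rewrite flatE // expRN.
have y0 : 0 < x^-1 by rewrite invr_gt0.
have := expR_ge1Dxn n.+1 (ltW y0).
set E := expR _ => HE.
have E0 : 0 < E by exact: expR_gt0.
have fp : 0 < (n.+2)`!%:R :> R by rewrite ltr0n fact_gt0.
rewrite ler_pdivrMr //.
have H : x^-1 ^+ n.+2 <= (n.+2)`!%:R * E.
  rewrite mulrC -ler_pdivrMr //; apply: le_trans HE; rewrite lerDr; exact: ler01.
have -> : x^-1 ^+ n = x ^+ 2 * x^-1 ^+ n.+2.
  by rewrite -[n.+2]add2n exprD mulrA -exprMn mulfV ?gt_eqF // expr1n mul1r.
by rewrite [leRHS]mulrAC [leRHS]mulrC ler_pM2l // exprn_gt0.
Qed.

(** Away from 0 this is the product rule; at 0 the difference quotient is O(|h|) by [flat_le_sqr].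
    The derivative stays in the span of the family, so smoothness follows by induction in
    [Ck_flat]. *)
Lemma is_derive_flat n (x : R) :
  is_derive x (1 : R) (flat n) (flat n.+2 x - n%:R * flat n.+1 x).
Proof.
have [x0|x0|->] := ltgtP x 0.
- rewrite !flat_le0 ?ltW // mulr0 subr0.
  apply: (@near_eq_is_derive _ _ _ (cst 0)).
  near=> y; rewrite flat_le0 //; apply: ltW; near: y; exact: lt_nbhsl.
- have xN0 : x != 0 by rewrite gt_eqF.
  apply: (@near_eq_is_derive _ _ _ (fun y : R => y^-1 ^+ n * expR (- y^-1) : R)).
    near=> y; rewrite flatE //; near: y; exact: lt_nbhsr.
  have dV : is_derive x 1 (fun y : R => y^-1) (- x ^- 2).
    have := @is_deriveV _ id x 1 1 xN0 (is_derive_id x 1).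
    by rewrite scaler1.
  have dX := @is_deriveX _ _ _ n x 1 _ dV.
  have dN := is_deriveN dV.
  have dE := @is_derive1_comp _ expR _ x _ _ (is_derive_expR _) dN.
  have dM := is_deriveM dX dE.
  have -> : (fun y : R => y^-1 ^+ n * expR (- y^-1) : R) =
      (fun y : R => y^-1) ^+ n * (expR \o - (fun y : R => y^-1)).
    by apply/funext => y; rewrite !fctE.
  apply: (is_derive_eq dM).
  rewrite !flatE // /GRing.scale /= !fctE /= opprK.
  case: n {dX dM} => [|n]; rewrite -!exprVn /=; first by rewrite !mulr0n; ring.
  by rewrite -[in n.+1%:R]natr1 !exprS -mulr_natr; ring.
- rewrite !flat_le0 // mulr0 subr0.
  suff H : (fun h => h^-1 *: ((flat n \o shift 0) h%:A - flat n 0)) @ 0^' --> (0 : R).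
    by apply: DeriveDef; [apply/cvg_ex; exists 0|exact: cvg_lim H].
  apply/cvgrPdist_le => /= e e0.
  pose C : R := (n.+2)`!%:R.
  have C0 : 0 < C by rewrite ltr0n fact_gt0.
  near=> h.
  have h0 : h != 0 by near: h; exact: nbhs_dnbhs_neq.
  rewrite sub0r normrN (flat_le0 n (lexx 0)) subr0 /= addr0 [h%:A]mulr1 /GRing.scale /=.
  rewrite normrM normfV ler_pdivrMl ?normr_gt0 // ger0_norm ?flat_ge0 //.
  apply: le_trans (flat_le_sqr n h) _.
  rewrite -/C -real_normK ?num_real // expr2 mulrA mulrC ler_wpM2l //.
  rewrite -ler_pdivlMl //; near: h; apply: dnbhs0_le.
  by rewrite mulr_gt0 // invr_gt0.
Unshelve. all: by end_near. Qed.

Lemma Ck_flat (V : normedModType R) (O : set V) k n (f : V -> R) : open O ->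
  Ck k O f -> Ck k O (flat n \o f).
Proof.
move=> oO; elim: k n => [|k IH] n Cf.
  move=> x Ox; apply: continuous_comp; first exact: Cf.
  apply/differentiable_continuous/derivable1_diffP.
  by have [] := is_derive_flat n (f x).
have [df dkf] := Cf; have Cf' := CkS Cf.
have D x (Ox : O x) v := derive_compR v (is_derive_flat n (f x)) (df x Ox).
split=> [x Ox|v]; first exact: (D x Ox 0).1.
have H := CkM oO (CkD oO (IH n.+2 Cf')
  (CkM oO (Ck_cst oO k (- n%:R : R)) (IH n.+1 Cf'))) (dkf v).
apply: (Ck_ext oO _ H) => x Ox.
by rewrite (D x Ox v).2 mulNr.
Qed.

(** A smooth step, 1 up to t = 1 and 0 from t = 2 on; the two terms of the denominator never vanish
    together. *)
Definition plateau (t : R) : R := flat 0 (2 - t) / (flat 0 (2 - t) + flat 0 (t - 1)).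

Lemma plateau_denom_gt0 t : 0 < flat 0 (2 - t) + flat 0 (t - 1).
Proof.
have [t2|t2] := ltP t 2.
  by rewrite ltr_wpDr ?flat_ge0 // flat_gt0 // subr_gt0.
rewrite ltr_wpDl ?flat_ge0 // flat_gt0 // subr_gt0; lra.
Qed.

Lemma plateau1 t : t <= 1 -> plateau t = 1.
Proof.
move=> t1; have := plateau_denom_gt0 t.
rewrite /plateau (@flat_le0 0 (t - 1)) ?subr_le0 // addr0 => /lt0r_neq0.
exact: divff.
Qed.

Lemma plateau0 t : 2 <= t -> plateau t = 0.
Proof. by move=> t2; rewrite /plateau flat_le0 ?mul0r // subr_le0. Qed.

Lemma Ck_plateau (V : normedModType R) (O : set V) k (f : V -> R) : open O ->
  Ck k O f -> Ck k O (plateau \o f).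
Proof.
move=> oO Cf.
have C1 : Ck k O (fun x => 2 - f x).
  have H := CkD oO (Ck_cst oO k (2 : R)) (CkM oO (Ck_cst oO k (-1 : R)) Cf).
  by apply: (Ck_ext oO _ H) => x _; rewrite mulN1r.
have C2 : Ck k O (fun x => f x - 1) := CkD oO Cf (Ck_cst oO k (-1 : R)).
apply: (CkM oO (Ck_flat 0 oO C1)); apply: (CkV oO).
  by move=> x _; rewrite gt_eqF // plateau_denom_gt0.
exact: (CkD oO (Ck_flat 0 oO C1) (Ck_flat 0 oO C2)).
Qed.

End Flat.

(** * Smooth functions on a manifold *)

Section SmoothOn.
Variables (R : realType) (M : manifold R).
Implicit Types (W : normedModType R) (O U : set M).

Local Notation dom i := (cdom (mchart i)).
Local Notation phi i := (cmap (mchart i)).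
Local Notation psi i := (cinv (mchart i)).

Lemma smooth_on_local W O (f : M -> W) :
  (forall m, O m -> exists2 U : set M, U m & smooth_on U f) -> smooth_on O f.
Proof.
move=> loc i k; apply: Ck_local => _ [m [im Om] <-].
have [U Um sU] := loc m Om.
by exists (phi i @` (dom i `&` U)); [exists m|exact: sU].
Qed.

Lemma smooth_on_sub W U O (f : M -> W) :
  U `<=` O -> smooth_on O f -> smooth_on U f.
Proof.
move=> UO sO i k; apply: Ck_sub (sO i k).
by apply: image_subset => m [im /UO].
Qed.

Section Open.
Variable O : set M.
Hypothesis oO : open O.

Let oI i := @chart_image_open R M i O oO.
Arguments oI : clear implicits.

Lemma smooth_on_ext W (f g : M -> W) :
  (forall m, O m -> f m = g m) -> smooth_on O f -> smooth_on O g.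
Proof.
move=> fg sf i k; apply: (Ck_ext (oI i) _ (sf i k)) => _ [m [im Om] <-] /=.
by rewrite cmapK //; exact: fg.
Qed.

Lemma smooth_on_cst W (a : W) : smooth_on O (fun=> a).
Proof. by move=> i k; exact: Ck_cst. Qed.

Lemma smooth_onD W (f g : M -> W) :
  smooth_on O f -> smooth_on O g -> smooth_on O (fun m => f m + g m).
Proof. by move=> sf sg i k; exact: (CkD (oI i) (sf i k) (sg i k)). Qed.

Lemma smooth_onM (f g : M -> R) :
  smooth_on O f -> smooth_on O g -> smooth_on O (fun m => f m * g m).
Proof. by move=> sf sg i k; exact: (CkM (oI i) (sf i k) (sg i k)). Qed.

Lemma smooth_onV (f : M -> R) : (forall m, O m -> f m != 0) ->
  smooth_on O f -> smooth_on O (fun m => (f m)^-1).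
Proof.
move=> f0 sf i k; apply: (CkV (oI i) _ (sf i k)) => _ [m [im Om] <-] /=.
by rewrite cmapK //; exact: f0.
Qed.

Lemma smooth_on_plateau (f : M -> R) :
  smooth_on O f -> smooth_on O (fun m => plateau (f m)).
Proof. by move=> sf i k; exact: (Ck_plateau (oI i) (sf i k)). Qed.

Lemma smooth_on_sum I (r : seq I) (P : pred I) (f : I -> M -> R) :
  (forall j, P j -> smooth_on O (f j)) ->
  smooth_on O (fun m => \sum_(j <- r | P j) f j m).
Proof.
move=> sf; elim: r => [|j r IH].
  by apply: smooth_on_ext (smooth_on_cst (0 : R)) => m _; rewrite big_nil.
case Pj : (P j); last first.
  by apply: smooth_on_ext IH => m _; rewrite big_cons Pj.
by apply: smooth_on_ext (smooth_onD (sf j Pj) IH) => m _; rewrite big_cons Pj.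
Qed.

Lemma smooth_on_prod I (r : seq I) (f : I -> M -> R) :
  (forall j, smooth_on O (f j)) ->
  smooth_on O (fun m => \prod_(j <- r) f j m).
Proof.
move=> sf; elim: r => [|j r IH].
  by apply: smooth_on_ext (smooth_on_cst (1 : R)) => m _; rewrite big_nil.
by apply: smooth_on_ext (smooth_onM (sf j) IH) => m _; rewrite big_cons.
Qed.

Lemma smooth_on_det n (B : M -> 'M[R]_n) :
  (forall a b, smooth_on O (fun m => B m a b)) ->
  smooth_on O (fun m => \det (B m)).
Proof.
move=> sB; apply: smooth_on_sum => s _.
by apply: smooth_onM (smooth_on_cst _) _; apply: smooth_on_prod => j; exact: sB.
Qed.

(** Cramer's rule: cofactors and determinant are polynomials in the entries. *)
Lemma smooth_on_invmx n (B : M -> 'M[R]_n) a b :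
  (forall a b, smooth_on O (fun m => B m a b)) ->
  (forall m, O m -> B m \in unitmx) ->
  smooth_on O (fun m => invmx (B m) a b).
Proof.
move=> sB uB.
have sC : smooth_on O (fun m => (\det (B m))^-1 * cofactor (B m) b a).
  apply: smooth_onM.
    apply: smooth_onV (smooth_on_det sB) => m /uB.
    by rewrite unitmxE unitfE.
  rewrite /cofactor; apply: smooth_onM (smooth_on_cst _) _.
  apply: smooth_on_det => c d.
  by apply: smooth_on_ext (sB (lift b c) (lift a d)) => m _; rewrite !mxE.
by apply: smooth_on_ext sC => m Om; rewrite /invmx uB // !mxE.
Qed.

Lemma smooth_on_rowP n (f : M -> 'rV[R]_n) :
  smooth_on O f <-> forall j, smooth_on O (fun m => f m 0 j).
Proof.
split=> [sf j i k|sf i k]; first exact: (Ck_coord (oI i) 0 j (sf i k)).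
by apply: (Ck_row (oI i)) => j; exact: (sf j i k).
Qed.

End Open.

Lemma smooth_on_chart (i : midx M) j : smooth_on (dom i) (fun m => phi i m 0 j).
Proof.
move=> l k; apply: (Ck_coord _ 0 j (mcompat l i k)).
exact/chart_image_open/cdom_open.
Qed.

(** The plateau is pulled back through a chart and extended by 0. K is the image of a compact set,
    hence closed because M is Hausdorff; the extension is then smooth, since the chart domain and
    the complement of K cover M. *)
Lemma smooth_bump O m : open O -> O m -> exists b : M -> R, exists2 K : set M,
  [/\ smooth b, \forall p \near m, b p = 1 & closed K] &
  K `<=` O /\ forall p, ~ K p -> b p = 0.
Proof.
move=> oO Om; pose i := chart_at m; have im : dom i m := chart_atP m.
pose c := phi i m.
have : nbhs c (phi i @` (dom i `&` O)).
  by apply: open_nbhs_nbhs; split; [exact: chart_image_open|exists m].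
move=> /nbhs_ballP[e /= e0 eO].
have d0 : 0 < (e / 4) ^+ 2 by rewrite exprn_gt0 // divr_gt0.
(* A sum of squares, as the sup norm is not smooth. Where q0 <= 2, each coordinate is within sqrt 2
   * e / 4 < e of that of c, so this set lies in the ball of radius e. *)
pose q0 (y : 'rV[R]_(mdim M)) : R :=
  ((e / 4) ^+ 2)^-1 * \sum_j (y 0 j - c 0 j) * (y 0 j - c 0 j).
have cq0 : continuous q0.
  have C k : Ck k [set: 'rV[R]_(mdim M)] id -> Ck k setT q0.
    move=> Cid; apply: (CkM openT (Ck_cst openT _ _)); apply: (Ck_sum openT) => j.
    have H := CkD openT (Ck_coord openT 0 j Cid) (Ck_cst openT k (- c 0 j : R)).
    exact: (CkM openT H H).
  by move=> y; apply: (C 0%N) => // z _; exact: cvg_id.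
pose K0 := q0 @^-1` [set x | x <= 2].
have K0ball : K0 `<=` ball c e.
  move=> y; rewrite /K0 /= /q0 ler_pdivrMl // => H; split=> // a j.
  rewrite (ord1 a) /ball /= ltr_norml.
  have Hj : (y 0 j - c 0 j) * (y 0 j - c 0 j) <= (e / 4) ^+ 2 * 2.
    apply: le_trans H; rewrite (bigD1 j) //= lerDl; apply: sumr_ge0 => l _.
    by rewrite -expr2 sqr_ge0.
  by apply/andP; split; nra.
have K0img := subset_trans K0ball eO.
have K0compact : compact K0.
  apply: bounded_closed_compact; last first.
    by apply: closed_comp (@closed_le _ 2) => y _; exact: cq0.
  exists (`|c| + e); split; first exact: num_real.
  move=> r Hr y /K0ball; rewrite -ball_normE /= => Hy; apply: ltW.
  apply: le_lt_trans Hr; rewrite -[y](subrK c) addrC.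
  by rewrite (le_trans (ler_normD _ _)) // lerD2l distrC ltW.
pose K := psi i @` K0.
have clK : closed K.
  apply: compact_closed; first exact: mhausdorff.
  apply: continuous_compact K0compact; apply: continuous_in_subspaceT => y.
  by rewrite inE => /K0img [p [ip _] <-]; apply: cinv_continuous; exists p.
have KUO : K `<=` dom i `&` O.
  by move=> _ [y /K0img [p ipO <-] <-]; rewrite cmapK //; case: ipO.
pose b p : R := if `[< dom i p >] then plateau (q0 (phi i p)) else 0.
have bE p : dom i p -> b p = plateau (q0 (phi i p)) by rewrite /b => /asboolT ->.
have b0 p : ~ K p -> b p = 0.
  rewrite /b; case: asboolP => // ip nK; apply: plateau0.
  have [//|/ltW H] := leP 2 (q0 (phi i p)).
  by case: nK; exists (phi i p) => //; rewrite cmapK.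
exists b, K; last by split=> // p /KUO[].
split=> //.
- apply: smooth_on_local => p _; have [Kp|nKp] := pselect (K p); last first.
    exists (~` K) => //; have oK := closed_openC clK.
    by apply: (smooth_on_ext oK) (smooth_on_cst oK (0 : R)) => x /b0.
  exists (dom i); first by have [] := KUO p Kp.
  have od := cdom_open (mchart i).
  apply: (smooth_on_ext od (fun m im => esym (bE m im))).
  apply: (smooth_on_plateau od); apply: (smooth_onM od (smooth_on_cst od _)).
  apply: (smooth_on_sum od) => j _.
  have H := smooth_onD od (@smooth_on_chart i j) (smooth_on_cst od (- c 0 j : R)).
  exact: (smooth_onM od H H).
- have cq : {for m, continuous (q0 \o phi i)}.
    by apply: continuous_comp; [exact: cmap_continuous|exact: cq0].
  have qm : q0 (phi i m) < 1.
    by rewrite /q0 big1 ?mulr0 ?ltr01 // => j _; rewrite subrr mulr0.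
  near=> p; rewrite bE; last first.
    near: p; apply: open_nbhs_nbhs; split=> //; exact: cdom_open.
  apply/plateau1/ltW; near: p.
  by apply: (cq [set x | x < 1]); exact: lt_nbhsl.
Unshelve. all: by end_near. Qed.

(** Extension by zero: outside O the values of f are arbitrary, but b is 0 on the open complement of
    K. *)
Lemma smooth_cutoff (b f : M -> R) (D O K : set M) : open D -> open O ->
  smooth b -> closed K -> K `<=` O -> (forall p, ~ K p -> b p = 0) ->
  smooth_on (D `&` O) f -> smooth_on D (fun p => b p * f p).
Proof.
move=> oD oO sb cK KO b0 sf; apply: smooth_on_local => p Dp.
have [Kp|nKp] := pselect (K p); last first.
  exists (~` K) => //; have oK := closed_openC cK.
  by apply: (smooth_on_ext oK) (smooth_on_cst oK (0 : R)) => x /b0->; rewrite mul0r.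
exists (D `&` O); first by split=> //; exact: KO.
have oDO : open (D `&` O) by exact: openI.
by apply: smooth_onM sf => //; apply: smooth_on_sub sb.
Qed.

End SmoothOn.

(** * Sections and the anchor *)

Section TangentDerive.
Variables (R : realType) (M : manifold R).
Implicit Types (i : midx M) (m : M) (f g : M -> R).

Local Notation dom i := (cdom (mchart i)).
Local Notation phi i := (cmap (mchart i)).
Local Notation psi i := (cinv (mchart i)).

Lemma smooth_differentiable f i m : smooth f -> dom i m ->
  differentiable (f \o psi i) (phi i m).
Proof. by move=> sf im; apply: (sf i 1%N).1; exists m. Qed.

(** [tangent_derive] uses the chart [chart_at m], which may jump with m. One fixed chart is needed
    to see that the result is smooth in m. *)
Lemma tangent_deriveE m (v : fibre (tangent_bundle M) m) f i :
  smooth f -> dom i m ->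
  tangent_derive v f = \sum_j tangent_coord i m v 0 j *
    'D_(delta_mx 0 j) (f \o psi i) (phi i m).
Proof.
move=> sf im; have mc := chart_atP m.
have df := smooth_differentiable sf im.
rewrite /tangent_derive deriveE; last exact: smooth_differentiable.
have <- : 'd (f \o psi i) (phi i m) (tangent_coord i m v) =
    'd (f \o psi (chart_at m)) (phi (chart_at m) m) v.
  apply: diff_comp_near => //.
  - by rewrite /transition /= cmapK.
  - exact: transition_differentiable.
  - apply: filterS (near_chart mc im) => _ [p [pc pi] <-].
    by rewrite /transition /= !cmapK.
by rewrite diff_rowE; apply: eq_bigr => j _; rewrite [in RHS]deriveE.
Qed.

Lemma tangent_derive_linear m (a : R) (v w : fibre (tangent_bundle M) m) f :
  smooth f -> tangent_derive (a *: v + w) f =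
    a * tangent_derive v f + tangent_derive w f.
Proof.
move=> sf; have df := smooth_differentiable sf (chart_atP m).
by rewrite /tangent_derive !deriveE // linearP.
Qed.

Lemma tangent_derive_cst m (v : fibre (tangent_bundle M) m) (a : R) :
  tangent_derive v (fun=> a) = 0.
Proof. exact: derive_cst. Qed.

Lemma tangent_deriveD m (v : fibre (tangent_bundle M) m) f g :
  smooth f -> smooth g -> tangent_derive v (fun p => f p + g p) =
    tangent_derive v f + tangent_derive v g.
Proof.
move=> sf sg; have df := smooth_differentiable sf (chart_atP m).
have dg := smooth_differentiable sg (chart_atP m).
by rewrite /tangent_derive -deriveD //; exact: diff_derivable.
Qed.

Lemma tangent_deriveM m (v : fibre (tangent_bundle M) m) f g :
  smooth f -> smooth g -> tangent_derive v (fun p => f p * g p) =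
    f m * tangent_derive v g + tangent_derive v f * g m.
Proof.
move=> sf sg; have df := smooth_differentiable sf (chart_atP m).
have dg := smooth_differentiable sg (chart_atP m).
rewrite /tangent_derive [LHS]deriveM; [|exact: diff_derivable..].
by rewrite /GRing.scale /= cmapK ?[_ * g m]mulrC //; exact: chart_atP.
Qed.

End TangentDerive.

(** * Smooth sections and frames *)

Section Sections.
Variables (R : realType) (M : manifold R).
Implicit Types (A B : vector_bundle M) (f : M -> R) (E : M -> lmodType R).

(** [tframe] is not assumed linear; it is so on the domain, as the inverse of the linear
    [tcoord]. *)
Lemma tframeE E r (t : trivialization E r) m x : tdom t m ->
  tframe t m x = \sum_b x 0 b *: tframe t m (delta_mx 0 b).
Proof.
move=> tm; apply: (can_inj (tcoordK tm)).
rewrite tframeK // linear_sum {1}(row_sum_delta x); apply: eq_bigr => b _.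
by rewrite linearZ /= tframeK.
Qed.

(** Stated for a family E so as to cover both the identity of A, read in a trivialization outside
    the atlas, and the anchor. *)
Lemma smooth_coord_map A E r (t : trivialization E r)
    (F : forall m, {linear fibre A m -> E m}) (u : section A) a :
  (forall i x, smooth_on (tdom (vtriv i) `&` tdom t)
    (fun m => tcoord t m (F m (tframe (vtriv i) m x)))) ->
  Sec A u -> smooth_on (tdom t) (fun m => tcoord t m (F m (u m)) 0 a).
Proof.
move=> sF Su; apply: smooth_on_local => m tm; have [i im] := vcover A m.
exists (tdom (vtriv i) `&` tdom t) => //.
have oU : open (tdom (vtriv i) `&` tdom t) by apply: openI; exact: tdom_open.
have H : smooth_on (tdom (vtriv i) `&` tdom t) (fun m => \sum_b
    tcoord (vtriv i) m (u m) 0 b *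
    tcoord t m (F m (tframe (vtriv i) m (delta_mx 0 b))) 0 a).
  apply: smooth_on_sum => // b _; apply: smooth_onM => //; last first.
    exact: (smooth_on_rowP oU _).1.
  apply: (smooth_on_rowP oU _).1; apply: smooth_on_sub (Su i).
  exact: subIsetl.
apply: smooth_on_ext H => // p [ip tp].
rewrite -[in RHS](tcoordK ip (u p)) [in RHS]tframeE // !linear_sum summxE.
by apply: eq_bigr => b _; rewrite !linearZ !mxE.
Qed.

Variable A : vector_bundle M.
Implicit Types u v : section A.

Lemma SecP u : Sec A u <-> forall i a,
  smooth_on (tdom (vtriv i)) (fun m => tcoord (vtriv i) m (u m) 0 a).
Proof.
by split=> S i; have /smooth_on_rowP H := tdom_open (vtriv i);
  [apply/H|apply/H => a]; exact: S.
Qed.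

Lemma smooth_setT (f : M -> R) (O : set M) : smooth f -> smooth_on O f.
Proof. by move=> sf; apply: smooth_on_sub sf. Qed.

Lemma Sec_lin f u v : smooth f -> Sec A u -> Sec A v ->
  Sec A (fun m => f m *: u m + v m).
Proof.
move=> sf /SecP Su /SecP Sv; apply/SecP => i a; have oi := tdom_open (vtriv i).
have H := smooth_onD oi (smooth_onM oi (smooth_setT _ sf) (Su i a)) (Sv i a).
apply: (smooth_on_ext oi _ H) => m _.
by rewrite linearP !mxE.
Qed.

Lemma Sec0 : Sec A (fun=> 0).
Proof.
apply/SecP => i a; have oi := tdom_open (vtriv i).
by apply: (smooth_on_ext oi _ (smooth_on_cst oi (0 : R))) => m _;
  rewrite linear0 mxE.
Qed.

Lemma smooth_cst (a : R) : smooth (fun _ : M => a).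
Proof. exact: (smooth_on_cst openT a). Qed.

Lemma SecZ f u : smooth f -> Sec A u -> Sec A (fun m => f m *: u m).
Proof.
move=> sf Su; have := Sec_lin sf Su Sec0.
by congr (Sec A _); apply/functional_extensionality_dep => m; rewrite addr0.
Qed.

Lemma SecD u v : Sec A u -> Sec A v -> Sec A (fun m => u m + v m).
Proof.
move=> Su Sv; have := Sec_lin (smooth_cst 1) Su Sv.
by congr (Sec A _); apply/functional_extensionality_dep => m; rewrite scale1r.
Qed.

Lemma Sec_sum I (r : seq I) (w : I -> section A) :
  (forall i, Sec A (w i)) -> Sec A (fun m => \sum_(i <- r) w i m).
Proof.
move=> Sw; elim: r => [|i r IH].
  have := Sec0.
  by congr (Sec A _); apply/functional_extensionality_dep => m; rewrite big_nil.
have := SecD (Sw i) IH.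
by congr (Sec A _); apply/functional_extensionality_dep => m; rewrite big_cons.
Qed.

Section Frame.
Variables (t : trivialization (fibre A) (rank A)).
Hypothesis tS : forall i : vidx A,
  smooth_change t (vtriv i) /\ smooth_change (vtriv i) t.

Lemma smooth_tcoord u a : Sec A u ->
  smooth_on (tdom t) (fun m => tcoord t m (u m) 0 a).
Proof.
by move=> Su; apply: (@smooth_coord_map A _ _ t (fun m => idfun)) => // i x;
  exact: (tS i).2.
Qed.

Lemma Sec_cutoff_frame (b : M -> R) (K : set M) x : smooth b -> closed K ->
  K `<=` tdom t -> (forall p, ~ K p -> b p = 0) ->
  Sec A (fun m => b m *: tframe t m x).
Proof.
move=> sb cK Kt b0; apply/SecP => i a.
have ot := tdom_open t; have oi := tdom_open (vtriv i).
have oti : open (tdom t `&` tdom (vtriv i)) by exact: openI.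
have /(smooth_on_rowP oti)/(_ a) H := (tS i).1 x.
have H2 := smooth_cutoff oi ot sb cK Kt b0.
apply: (smooth_on_ext oi _ (H2 _ _)); last by rewrite setIC; exact: H.
by move=> m _ /=; rewrite linearZ mxE.
Qed.

End Frame.

End Sections.

Section AnchorDerive.
Variables (R : realType) (M : manifold R) (A : lie_algebroid M).
Implicit Types (u v : section A) (f g h : M -> R).

Lemma smooth_anchor_derive u f : Sec A u -> smooth f -> smooth (anchor_derive u f).
Proof.
move=> Su sf i k.
have oi := @chart_image_open R M i setT openT.
have od : cdom (mchart i) `&` setT = tdom (tangent_triv i) `&` cdom (mchart i).
  by rewrite setIT setIid.
have H : Ck k (cmap (mchart i) @` (cdom (mchart i) `&` setT)) (fun y => \sum_j
   tcoord (tangent_triv i) (cinv (mchart i) y)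
     (la_anchor A (cinv (mchart i) y) (u (cinv (mchart i) y))) 0 j *
   'D_(delta_mx 0 j) (f \o cinv (mchart i)) y).
  apply: (Ck_sum oi) => j; apply: (CkM oi); last exact: (sf i k.+1).2.
  rewrite od; apply: (@smooth_coord_map _ _ A _ _ (tangent_triv i) (la_anchor A)
    u j _ Su i k) => l x.
  exact: (bmap_smooth (la_anchor A) l (i : vidx (tangent_bundle M))).
apply: (Ck_ext oi _ H) => _ [m [im _] <-].
by rewrite /= cmapK // /anchor_derive (tangent_deriveE _ sf im).
Qed.

Lemma anchor_derive_linear f u v h : smooth h -> forall m,
  anchor_derive (fun p => f p *: u p + v p) h m =
  f m * anchor_derive u h m + anchor_derive v h m.
Proof. by move=> sh m; rewrite /anchor_derive linearP tangent_derive_linear. Qed.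

Lemma anchor_deriveD u f g : smooth f -> smooth g -> forall m,
  anchor_derive u (fun p => f p + g p) m = anchor_derive u f m + anchor_derive u g m.
Proof. by move=> sf sg m; exact: tangent_deriveD. Qed.

Lemma anchor_deriveM u f g : smooth f -> smooth g -> forall m,
  anchor_derive u (fun p => f p * g p) m =
  f m * anchor_derive u g m + anchor_derive u f m * g m.
Proof. by move=> sf sg m; exact: tangent_deriveM. Qed.

Lemma anchor_derive_cst u (a : R) m : anchor_derive u (fun=> a) m = 0.
Proof. exact: tangent_derive_cst. Qed.

End AnchorDerive.

(** * Weighted Carrollian connections *)

Section Tensorial.
Variables (R : realType) (M : manifold R) (A : vector_bundle M).
Implicit Types u v : section A.

Lemma Sec_local u :
  (forall m : M, exists2 w, Sec A w & \forall p \near m, u p = w p) -> Sec A u.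
Proof.
move=> loc; apply/SecP => i a; apply: smooth_on_local => m im.
have [w /SecP Sw uw] := loc m.
have oU : open (tdom (vtriv i) `&` interior [set p | u p = w p]).
  by apply: openI; [exact: tdom_open|exact: open_interior].
exists (tdom (vtriv i) `&` interior [set p | u p = w p]) => //.
have H : smooth_on (tdom (vtriv i) `&` interior [set p | u p = w p])
    (fun p => tcoord (vtriv i) p (w p) 0 a).
  by apply: smooth_on_sub (Sw i a); exact: subIsetl.
by apply: (smooth_on_ext oU _ H) => p [_ /interior_subset /= ->].
Qed.

Definition tensorial (Phi : section A -> M -> R) := forall (f : M -> R) u v,
  smooth f -> Sec A u -> Sec A v ->
  forall m, Phi (fun p => f p *: u p + v p) m = f m * Phi u m + Phi v m.

Variable Phi : section A -> M -> R.
Hypothesis tPhi : tensorial Phi.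

Lemma tensorial0 m : Phi (fun=> 0) m = 0.
Proof.
have := tPhi (@smooth_cst R M 1) (@Sec0 R M A) (@Sec0 R M A) m.
rewrite mul1r (_ : (fun p => _) = (fun=> 0)); last first.
  by apply/functional_extensionality_dep => p; rewrite scaler0 addr0.
by move/eqP; rewrite -{1}[Phi _ m]addr0 (can_eq (addKr _)) => /eqP.
Qed.

Lemma tensorialZ f u : smooth f -> Sec A u ->
  forall m, Phi (fun p => f p *: u p) m = f m * Phi u m.
Proof.
move=> sf Su m; have := tPhi sf Su (@Sec0 R M A) m.
rewrite tensorial0 addr0 => <-; congr Phi.
by apply/functional_extensionality_dep => p; rewrite addr0.
Qed.

Lemma tensorial_sum I (r : seq I) (f : I -> M -> R) (w : I -> section A) :
  (forall i, smooth (f i)) -> (forall i, Sec A (w i)) ->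
  forall m, Phi (fun p => \sum_(i <- r) f i p *: w i p) m =
    \sum_(i <- r) f i m * Phi (w i) m.
Proof.
move=> sf Sw m; elim: r => [|i r IH].
  rewrite big_nil -(tensorial0 m); congr Phi.
  by apply/functional_extensionality_dep => p; rewrite big_nil.
rewrite big_cons -IH -tPhi //; last by apply: Sec_sum => j; exact: SecZ.
congr Phi.
by apply/functional_extensionality_dep => p; rewrite big_cons.
Qed.

(** For a bump b that is 1 at m and supported where u = v, the sections b u and b v coincide. *)
Lemma tensorial_local u v m : Sec A u -> Sec A v ->
  (\forall p \near m, u p = v p) -> Phi u m = Phi v m.
Proof.
move=> Su Sv uv.
have [b [K [sb b1 _] [Ksub b0]]] := smooth_bump (@open_interior _ _) uv.
have := tensorialZ sb Su m; have := tensorialZ sb Sv m.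
rewrite (nbhs_singleton b1) !mul1r => <- <-; congr Phi.
apply/functional_extensionality_dep => p.
have [/Ksub/interior_subset/= ->//|/b0 ->] := pselect (K p).
by rewrite !scale0r.
Qed.

End Tensorial.

Section Weighted.
Variables (R : realType) (M : manifold R) (A : carrollian_lie_algebroid M).
Local Notation g := (@ca_metric R M A).
Local Notation L := (@ca_line R M A).
Local Notation Lat m := (@ca_line R M A m).
Local Notation rho := (@anchor_derive R M A).
Local Notation S := (Sec A).
Implicit Types (u v w : section A) (f h : M -> R) (m : M).
Implicit Types N : section A -> section A -> section A.

Lemma tensorial_metricl v : S v -> tensorial (g^~ v).
Proof. by move=> Sv f u u' sf Su Su' m; exact: (g_linear (ca_metricP A)). Qed.

Lemma ca_metricC u v : S u -> S v -> g u v = g v u.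
Proof. by move=> Su Sv; apply/funext => m; exact: (g_sym (ca_metricP A)). Qed.

Lemma tensorial_metricr u : S u -> tensorial (g u).
Proof.
move=> Su f v v' sf Sv Sv' m.
rewrite ![g u _]ca_metricC //; last exact: Sec_lin.
exact: tensorial_metricl.
Qed.

Lemma metric_suml I (r : seq I) (f : I -> M -> R) (w : I -> section A) v m :
  (forall i, smooth (f i)) -> (forall i, S (w i)) -> S v ->
  g (fun p => \sum_(i <- r) f i p *: w i p) v m =
  \sum_(i <- r) f i m * g (w i) v m.
Proof. by move=> sf Sw Sv; exact: (tensorial_sum (tensorial_metricl Sv)). Qed.

Lemma smooth_metric u v : S u -> S v -> smooth (g u v).
Proof. exact: (g_smooth (ca_metricP A)). Qed.

Lemma metric_SecLl u v : SecL L u -> S v -> g u v = fun=> 0.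
Proof. by rewrite -ca_kerE => -[_ H] Sv; apply/funext => m; exact: H. Qed.

Lemma metric_SecLr u v : S u -> SecL L v -> g u v = fun=> 0.
Proof.
by move=> Su Lv; have [Sv _] := Lv; rewrite ca_metricC // metric_SecLl.
Qed.

Lemma line_linear m (a : R) (x y : fibre A m) : Lat m x -> Lat m y -> Lat m (a *: x + y).
Proof.
have [[_ sub] _] := ca_lineP A; have [t [tm _ LE]] := sub m.
rewrite LE //= => Lx Ly j j1.
by rewrite linearP !mxE Lx // Ly // mulr0 addr0.
Qed.

Lemma line0 m : Lat m 0.
Proof.
have [[_ sub] _] := ca_lineP A; have [t [tm _ LE]] := sub m.
by rewrite LE //= => j j1; rewrite linear0 mxE.
Qed.

Lemma line_sum m I (r : seq I) (x : I -> fibre A m) :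
  (forall i, Lat m (x i)) -> Lat m (\sum_(i <- r) x i).
Proof.
move=> Lx; apply: (big_ind (Lat m)) => //; first exact: line0.
by move=> y z Ly Lz; rewrite -[y]scale1r; exact: line_linear.
Qed.

Lemma lineZ m (a : R) (x : fibre A m) : Lat m x -> Lat m (a *: x).
Proof. by move=> Lx; rewrite -[_ *: _]addr0; apply: line_linear => //; exact: line0. Qed.

Record weighted_connection f N : Prop := {
  wc_smooth : smooth f;
  wc_Sec : forall u v, S u -> S v -> S (N u v);
  wc_tensorial : forall h u u' v, smooth h -> S u -> S u' -> S v ->
    forall m, N (fun p => h p *: u p + u' p) v m = h m *: N u v m + N u' v m;
  wc_leibniz : forall h u v v', smooth h -> S u -> S v -> S v' -> forall m,
    N u (fun p => h p *: v p + v' p) m =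
    h m *: N u v m + (f m * rho u h m) *: v m + N u v' m;
  wc_line : forall u v, S u -> SecL L v -> forall m, Lat m (N u v m);
  wc_metric : forall u v w, S u -> S v -> S w -> forall m,
    f m * rho u (g v w) m = g (N u v) w m + g v (N u w) m }.

Lemma weighted_connection0 : weighted_connection (fun=> 0) (fun _ _ _ => 0).
Proof.
split.
- exact: smooth_cst.
- by move=> u v _ _; exact: Sec0.
- by move=> h u u' v *; rewrite scaler0 addr0.
- by move=> h u u' v *; rewrite scaler0 mul0r scale0r !addr0.
- by move=> *; exact: line0.
- move=> u v w Su Sv Sw m.
  rewrite mul0r (tensorial0 (tensorial_metricl Sw)).
  by rewrite (tensorial0 (tensorial_metricr Sv)) addr0.
Qed.

Lemma weighted_connection_comb h f f' N N' : smooth h ->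
  weighted_connection f N -> weighted_connection f' N' ->
  weighted_connection (fun m => h m * f m + f' m)
    (fun u v m => h m *: N u v m + N' u v m).
Proof.
move=> sh wN wN'; split.
- apply: smooth_onD (wc_smooth wN'); first exact: openT.
  exact: (smooth_onM openT sh (wc_smooth wN)).
- by move=> u v Su Sv; apply: Sec_lin => //; [exact: wc_Sec wN _ _ _ _|exact: wc_Sec wN' _ _ _ _].
- move=> k u u' v sk Su Su' Sv m; rewrite (wc_tensorial wN) // (wc_tensorial wN') //.
  by rewrite !scalerDr !scalerA [h m * _]mulrC addrACA.
- move=> k u v v' sk Su Sv Sv' m; rewrite (wc_leibniz wN) // (wc_leibniz wN') //.
  rewrite !scalerDr !scalerA mulrDl scalerDl [h m * k m]mulrC mulrA.
  by rewrite addrACA [X in X + _ = _]addrACA.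
- by move=> u v Su Lv m; apply: line_linear; [exact: wc_line wN _ _ _ _ _|exact: wc_line wN' _ _ _ _ _].
- move=> u v w Su Sv Sw m.
  rewrite (tensorial_metricl Sw) //; [|exact: wc_Sec wN _ _ _ _|exact: wc_Sec wN' _ _ _ _].
  rewrite (tensorial_metricr Sv) //; [|exact: wc_Sec wN _ _ _ _|exact: wc_Sec wN' _ _ _ _].
  rewrite mulrDl -mulrA (wc_metric wN) // (wc_metric wN') //; ring.
Qed.

Definition weighted := ((M -> R) * (section A -> section A -> section A))%type.

(** The weights satisfy 1 - G_(k+1) = (1 - G_k)(1 - F_k). Once G_k is 1 at a point, all later terms
    enter there with coefficient 0, so the sequence is stationary and no infinite sum is needed. *)
Fixpoint glue (F : nat -> weighted) (k : nat) : weighted :=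
  if k is k'.+1 then
    let G := glue F k' in
    (fun m => (1 - G.1 m) * (F k').1 m + G.1 m,
     fun u v m => (1 - G.1 m) *: (F k').2 u v m + G.2 u v m)
  else (fun=> 0, fun _ _ _ => 0).

Section Glue.
Variable F : nat -> weighted.
Hypothesis wF : forall k, weighted_connection (F k).1 (F k).2.

Lemma glue_weighted k : weighted_connection (glue F k).1 (glue F k).2.
Proof.
elim: k => [|k IH] /=; first exact: weighted_connection0.
apply: (weighted_connection_comb _ _ IH) => //.
have H := smooth_onD openT (@smooth_cst R M 1)
  (smooth_onM openT (@smooth_cst R M (-1)) (wc_smooth IH)).
by apply: (smooth_on_ext openT _ H) => m _; rewrite mulN1r.
Qed.

Lemma glue_stationary k l m : (glue F k).1 m = 1 -> (k <= l)%N ->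
  (glue F l).1 m = 1 /\ forall u v, (glue F l).2 u v m = (glue F k).2 u v m.
Proof.
move=> k1 /subnK <-; elim: (l - k)%N => [|n [IH1 IH2]] //=.
rewrite IH1 subrr mul0r add0r; split=> // u v.
by rewrite scale0r add0r; exact: IH2.
Qed.

Hypothesis F1 : forall m, exists k, \forall p \near m, (F k).1 p = 1.

Lemma glue1 m : exists k, \forall p \near m, (glue F k).1 p = 1.
Proof.
have [k k1] := F1 m; exists k.+1; apply: filterS k1 => p /= ->.
by rewrite mulr1 subrK.
Qed.

Lemma glued_connection : exists nabla, carrollian_connection (A := A) nabla.
Proof.
have [n n1] := choice glue1.
(* The index n m varies wildly with m, but by [glue_stationary] any index of weight 1 at the point
   gives the same value. Near m, nabla thus agrees with the single stage n m. *)
pose nabla u v m := (glue F (n m)).2 u v m.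
have nablaE k m : (glue F k).1 m = 1 -> forall u v,
    nabla u v m = (glue F k).2 u v m.
  move=> k1 u v; have nm1 := nbhs_singleton (n1 m).
  have [/(glue_stationary nm1)[_ ->]//|/ltnW/(glue_stationary k1)[_]] :=
    leqP (n m) k.
  exact.
have Sn u v : S u -> S v -> S (nabla u v).
  move=> Su Sv; apply: Sec_local => m; exists ((glue F (n m)).2 u v).
    exact: wc_Sec (glue_weighted _) _ _ _ _.
  by apply: filterS (n1 m) => p p1; exact: nablaE.
have nE m := nablaE _ _ (nbhs_singleton (n1 m)).
have Z0 (f : M -> R) (u : section A) : (fun p => f p *: u p) =
    (fun p => f p *: u p + (fun=> 0) p).
  by apply/functional_extensionality_dep => p; rewrite addr0.
(* The axioms always carry a second summand; writing 0 as - u + u shows that the operators vanish on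
   the zero section. *)
have zeroE (u : section A) : (fun=> 0) = (fun p => (fun=> -1) p *: u p + u p).
  by apply/functional_extensionality_dep => p; rewrite scaleN1r addNr.
exists nabla; split; [split; [split|..]|..].
- exact: Sn.
- move=> a u u' v Su Su' Sv m; rewrite !nE.
  exact: (wc_tensorial (glue_weighted _) (@smooth_cst R M a)).
- move=> a u v v' Su Sv Sv' m; rewrite !nE.
  rewrite (wc_leibniz (glue_weighted _) (@smooth_cst R M a)) //.
  by rewrite anchor_derive_cst mulr0 scale0r addr0.
- move=> f u v sf Su Sv m; rewrite !nE Z0.
  rewrite (wc_tensorial (glue_weighted _) sf Su (@Sec0 R M A) Sv).
  suff -> : (glue F (n m)).2 (fun=> 0) v m = 0 by rewrite addr0.
  rewrite (zeroE u) (wc_tensorial (glue_weighted _) (@smooth_cst R M (-1))) //.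
  by rewrite scaleN1r addNr.
- move=> f u v sf Su Sv m; rewrite !nE Z0.
  rewrite (wc_leibniz (glue_weighted _) sf Su Sv (@Sec0 R M A)).
  rewrite (nbhs_singleton (n1 m)) mul1r.
  suff -> : (glue F (n m)).2 u (fun=> 0) m = 0 by rewrite addr0.
  rewrite (zeroE v) (wc_leibniz (glue_weighted _) (@smooth_cst R M (-1))) //.
  by rewrite anchor_derive_cst mulr0 scale0r addr0 scaleN1r addNr.
- move=> u v Su Lv; split=> [|m]; first by apply: Sn => //; case: Lv.
  by rewrite nE; exact: wc_line (glue_weighted _) _ _ _ _ _.
- move=> u v w Su Sv Sw m.
  (* The metric takes whole sections, so equality at m is not enough; equality near m is, by
     [tensorial_local]. *)
  have near_nabla v' : \forall p \near m, nabla u v' p = (glue F (n m)).2 u v' p.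
    by apply: filterS (n1 m) => p p1; exact: nablaE.
  have SG v' : S v' -> S ((glue F (n m)).2 u v').
    by move=> Sv'; exact: wc_Sec (glue_weighted _) _ _ _ _.
  rewrite (tensorial_local (tensorial_metricl Sw) _ _ (near_nabla v)); [|exact: Sn|exact: SG].
  rewrite (tensorial_local (tensorial_metricr Sv) _ _ (near_nabla w)); [|exact: Sn|exact: SG].
  by rewrite -(wc_metric (glue_weighted _)) // (nbhs_singleton (n1 m)) mul1r.
Qed.

End Glue.

(** The sequence to be glued is indexed by the codes of a countable base: a base set on which some
    weighted connection has weight 1 receives one, every other index receives zero. The base sets of
    the first kind cover M. *)
Lemma local_to_global :
  (forall m0, exists f N, weighted_connection f N /\ \forall m \near m0, f m = 1) ->
  exists nabla, carrollian_connection (A := A) nabla.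
Proof.
move=> loc; have [B /countable_injP[code code_inj] [Bo Bb]] := @msecond_countable R M.
pose good (b : set M) (G : weighted) :=
  weighted_connection G.1 G.2 /\ forall p, b p -> G.1 p = 1.
have /choice[F FP] (n : nat) : exists G : weighted,
    weighted_connection G.1 G.2 /\ forall b, B b -> code b = n ->
    (exists G', good b G') -> forall p, b p -> G.1 p = 1.
  have [[b [Bb1 bn [G [wG G1]]]]|no] :=
      pselect (exists b, [/\ B b, code b = n & exists G, good b G]).
    exists G; split=> // b' Bb' b'n _ p b'p; apply: G1.
    by rewrite (code_inj b b') ?inE // bn b'n.
  exists (fun=> 0, fun _ _ _ => 0); split; first exact: weighted_connection0.
  by move=> b Bb1 bn ex; case: no; exists b.
apply: (@glued_connection F) => [k|m]; first exact: (FP k).1.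
have [f [N [wN f1]]] := loc m.
have [b [Bb1 bm] bf] := Bb m _ f1.
exists (code b).
have /open_nbhs_nbhs : open_nbhs m b by split=> //; exact: Bo.
apply: filterS => p bp; apply: ((FP (code b)).2 b) => //.
by exists (f, N).
Qed.

End Weighted.

(** * Local existence *)

Section AdaptedFrame.
Variables (R : realType) (M : manifold R) (A : carrollian_lie_algebroid M).
Local Notation g := (@ca_metric R M A).
Local Notation L := (@ca_line R M A).
Local Notation Lat m := (@ca_line R M A m).
Local Notation rho := (@anchor_derive R M A).
Local Notation S := (Sec A).
Local Notation r := (rank A).
Implicit Types (u v w : section A) (f h : M -> R) (m : M).

(* e is a frame of A and eps are the coordinates in it, both multiplied by a  *)
(* cutoff function with square chi; the 0-th vector spans L.  For a > 0, e' a *)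
(* is b times the dual of e a for the metric induced by g on A / L.           *)
Record adapted_frame (b chi : M -> R) (e e' : 'I_r -> section A)
    (eps : 'I_r -> section A -> M -> R) : Prop := {
  af_smooth : smooth b;
  af_smooth_chi : smooth chi;
  af_chi : forall m, b m * chi m = b m;
  af_e : forall a, S (e a);
  af_e' : forall a, S (e' a);
  af_smooth_eps : forall a u, S u -> smooth (eps a u);
  af_eps : forall a f u v m,
    eps a (fun p => f p *: u p + v p) m = f m * eps a u m + eps a v m;
  af_decomp : forall u m, \sum_a eps a u m *: e a m = chi m *: u m;
  af_line_e : forall a : 'I_r, (a < 1)%N -> forall m, Lat m (e a m);
  af_line_eps : forall a : 'I_r, (1 <= a)%N -> forall u m,
    Lat m (u m) -> eps a u m = 0;
  af_dual : forall (a : 'I_r) w m, S w ->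
    g (e' a) w m = if (1 <= a)%N then b m * eps a w m else 0 }.

Variables (b chi : M -> R) (e e' : 'I_r -> section A)
  (eps : 'I_r -> section A -> M -> R).
Hypothesis fr : adapted_frame b chi e e' eps.

(** Where the cutoff is locally 1, this is the flat connection with the frame parallel. In general
    its Leibniz rule has weight chi. *)
Definition frame_connection u v : section A :=
  fun m => \sum_a rho u (eps a v) m *: e a m.
Local Notation D := frame_connection.

(** The factor chi matches the weight of D, so that the derivatives of coefficients cancel and Q is
    tensorial on all of M. *)
Definition metric_defect u v w : M -> R :=
  fun m => chi m * rho u (g v w) m - g (D u v) w m - g v (D u w) m.
Local Notation Q := metric_defect.

(** The second term is half of Q with an index raised; its factor b is already contained in e'. *)
Definition corrected_connection u v : section A :=
  fun m => b m *: D u v m + \sum_a (2^-1 * Q u v (e a) m) *: e' a m.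

Let Seps := af_smooth_eps fr.

Lemma Sec_frame_connection u v : S u -> S v -> S (D u v).
Proof.
move=> Su Sv; apply: Sec_sum => a; apply: SecZ; last exact: (af_e fr).
by apply: smooth_anchor_derive => //; exact: Seps.
Qed.
Let SD := Sec_frame_connection.

Lemma frame_connection_tensorial h u u' v : smooth h -> S u -> S u' -> S v ->
  forall m, D (fun p => h p *: u p + u' p) v m = h m *: D u v m + D u' v m.
Proof.
move=> sh Su Su' Sv m; rewrite /D scaler_sumr -big_split; apply: eq_bigr => a _ /=.
by rewrite anchor_derive_linear ?scalerDl ?scalerA //; exact: Seps.
Qed.

Lemma frame_connection_leibniz h u v v' : smooth h -> S u -> S v -> S v' ->
  forall m, D u (fun p => h p *: v p + v' p) m =
    h m *: D u v m + (chi m * rho u h m) *: v m + D u v' m.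
Proof.
move=> sh Su Sv Sv' m.
rewrite [chi m * _]mulrC -scalerA -(af_decomp fr) /D !scaler_sumr -!big_split.
apply: eq_bigr => a _ /=.
have -> : eps a (fun p => h p *: v p + v' p) =
    fun p => (fun p => h p * eps a v p) p + eps a v' p.
  by apply/funext => p; exact: (af_eps fr).
have sv := Seps a Sv; have sv' := Seps a Sv'.
rewrite anchor_deriveD //; last exact: (smooth_onM openT sh sv).
by rewrite anchor_deriveM // !scalerDl !scalerA.
Qed.

Lemma smooth_metric_defect u v w : S u -> S v -> S w -> smooth (Q u v w).
Proof.
move=> Su Sv Sw.
have H1 := smooth_onM openT (af_smooth_chi fr)
  (smooth_anchor_derive Su (smooth_metric Sv Sw)).
have N1 := @smooth_cst R M (-1).
have H2 := smooth_onM openT N1 (smooth_metric (SD Su Sv) Sw).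
have H3 := smooth_onM openT N1 (smooth_metric Sv (SD Su Sw)).
have H := smooth_onD openT (smooth_onD openT H1 H2) H3.
by apply: (smooth_on_ext openT _ H) => m _; rewrite !mulN1r.
Qed.

Lemma metric_defect_sym u v w : S u -> S v -> S w -> Q u v w = Q u w v.
Proof.
move=> Su Sv Sw; apply/funext => m.
rewrite /Q (ca_metricC Sv Sw) (ca_metricC (SD Su Sv) Sw) (ca_metricC Sv (SD Su Sw)).
by rewrite addrAC.
Qed.

Lemma metric_defect_tensorial h u u' v w : smooth h -> S u -> S u' -> S v -> S w ->
  forall m, Q (fun p => h p *: u p + u' p) v w m = h m * Q u v w m + Q u' v w m.
Proof.
move=> sh Su Su' Sv Sw m; have Svw := smooth_metric Sv Sw.
have DE v' : S v' -> D (fun p => h p *: u p + u' p) v' =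
    (fun p => h p *: D u v' p + D u' v' p).
  move=> Sv'; apply/functional_extensionality_dep => p.
  exact: frame_connection_tensorial.
rewrite /Q !DE // anchor_derive_linear //.
rewrite (tensorial_metricl Sw) ?(tensorial_metricr Sv) //; try exact: SD.
ring.
Qed.

Lemma metric_defect_tensoriall u w : S u -> S w -> tensorial (Q u ^~ w).
Proof.
move=> Su Sw h v v' sh Sv Sv' m.
have DE : D u (fun p => h p *: v p + v' p) =
    (fun p => h p *: D u v p + (chi p * rho u h p *: v p + D u v' p)).
  apply/functional_extensionality_dep => p.
  by rewrite frame_connection_leibniz // addrA.
have gE : g (fun p => h p *: v p + v' p) w =
    fun p => (fun p => h p * g v w p) p + g v' w p.
  by apply/funext => p; exact: tensorial_metricl.
have srho : smooth (fun p => chi p * rho u h p).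
  by apply: (smooth_onM openT (af_smooth_chi fr)); exact: smooth_anchor_derive.
have sg := smooth_metric Sv Sw; have sg' := smooth_metric Sv' Sw.
have SDv := SD Su Sv; have SDv' := SD Su Sv'; have SDw := SD Su Sw.
rewrite /Q DE gE anchor_deriveD //; last exact: (smooth_onM openT sh sg).
rewrite anchor_deriveM // !(tensorial_metricl Sw) //; last exact: Sec_lin.
rewrite (tensorial_metricl SDw) //; ring.
Qed.

Lemma line_frame_connection u v : S u -> SecL L v -> forall m, Lat m (D u v m).
Proof.
move=> Su [Sv Lv] m; apply: line_sum => a; have [a1|a1] := ltnP a 1.
  by apply: lineZ; exact: (af_line_e fr).
have -> : eps a v = fun=> 0 by apply/funext => p; exact: (af_line_eps fr).
by rewrite anchor_derive_cst scale0r; exact: line0.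
Qed.

(** Each term has an argument of g in L: v itself, or D_u v because D preserves L. Hence Q descends
    to A / L. *)
Lemma metric_defect_line u v w : S u -> SecL L v -> S w -> Q u v w = fun=> 0.
Proof.
move=> Su Lv Sw; have [Sv _] := Lv; apply/funext => m.
have LD : SecL L (D u v).
  by split; [exact: SD|exact: line_frame_connection].
rewrite /Q (metric_SecLl Lv Sw) (metric_SecLl LD Sw) (metric_SecLl Lv (SD Su Sw)).
by rewrite anchor_derive_cst mulr0 !subr0.
Qed.

Let SQe u v a : S u -> S v -> smooth (fun p => 2^-1 * Q u v (e a) p).
Proof.
move=> Su Sv; apply: (smooth_onM openT (@smooth_cst R M 2^-1)).
by apply: smooth_metric_defect => //; exact: (af_e fr).
Qed.

Let Scorr u v : S u -> S v ->
  S (fun m => \sum_a (2^-1 * Q u v (e a) m) *: e' a m).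
Proof.
move=> Su Sv; apply: Sec_sum => a; apply: SecZ; last exact: (af_e' fr).
exact: SQe.
Qed.

(** Pairing with w recovers Q from its values on the frame. The direction of L, absent from the dual
    frame, is not missed because Q vanishes on it; the factor chi of the expansion is absorbed by
    b. *)
Lemma metric_corrected u v w m : S u -> S v -> S w ->
  g (corrected_connection u v) w m = b m * g (D u v) w m + 2^-1 * (b m * Q u v w m).
Proof.
move=> Su Sv Sw; have sb := af_smooth fr.
rewrite /corrected_connection (tensorial_metricl Sw) //; [|exact: SD|exact: Scorr].
congr (_ + _).
rewrite metric_suml //; [|by move=> a; exact: SQe|exact: (af_e' fr)].
transitivity (2^-1 * (b m * \sum_a eps a w m * Q u v (e a) m)).
  rewrite !mulr_sumr; apply: eq_bigr => a _; rewrite (af_dual fr) //.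
  case: ltnP => a1; first by ring.
  have Le : SecL L (e a) by split; [exact: (af_e fr)|exact: (af_line_e fr)].
  rewrite metric_defect_sym //; last exact: (af_e fr).
  by rewrite (metric_defect_line Su Le Sv) !mulr0.
have tQ : tensorial (Q u v).
  move=> h w' w'' sh Sw' Sw'' p; rewrite ![Q u v _]metric_defect_sym //; last exact: Sec_lin.
  exact: metric_defect_tensoriall.
rewrite -(@tensorial_sum _ _ _ _ tQ _ _ (fun a => eps a w) e) => [|a|a];
  [|exact: Seps|exact: (af_e fr)].
rewrite (_ : (fun p => _) = (fun p => chi p *: w p)); last first.
  by apply/functional_extensionality_dep => p; exact: (af_decomp fr).
by rewrite (tensorialZ tQ (af_smooth_chi fr) Sw) mulrA (af_chi fr).
Qed.

Lemma corrected_weighted : weighted_connection b corrected_connection.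
Proof.
have sb := af_smooth fr; split=> //.
- by move=> u v Su Sv; apply: Sec_lin => //; [exact: SD|exact: Scorr].
- move=> h u u' v sh Su Su' Sv m; rewrite /corrected_connection.
  rewrite frame_connection_tensorial // !scalerDr !scalerA [h m * _]mulrC.
  rewrite [RHS]addrACA; congr (_ + _); rewrite scaler_sumr -big_split.
  apply: eq_bigr => a _ /=; rewrite metric_defect_tensorial //; last exact: (af_e fr).
  by rewrite scalerA -scalerDl mulrDr mulrCA.
- move=> h u v v' sh Su Sv Sv' m; rewrite /corrected_connection.
  rewrite frame_connection_leibniz // !scalerDr !scalerA [h m * _]mulrC.
  rewrite [b m * (chi m * _)]mulrA (af_chi fr).
  rewrite -!addrA; congr (_ + _).
  rewrite [RHS]addrCA; congr (_ + _); rewrite [RHS]addrCA; congr (_ + _).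
  rewrite scaler_sumr -big_split.
  apply: eq_bigr => a _ /=; have Se := af_e fr a.
  rewrite (metric_defect_tensoriall Su Se) //.
  by rewrite scalerA -scalerDl mulrDr mulrCA.
- move=> u v Su Lv m; have [Sv _] := Lv; apply: line_linear.
    exact: line_frame_connection.
  rewrite big1; [exact: line0|move=> a _].
  by rewrite (metric_defect_line Su Lv (af_e fr a)) mulr0 scale0r.
- move=> u v w Su Sv Sw m.
  have SN : S (corrected_connection u w).
    by apply: Sec_lin => //; [exact: SD|exact: Scorr].
  rewrite metric_corrected // (ca_metricC Sv SN) metric_corrected //.
  rewrite (metric_defect_sym Su Sw Sv) (ca_metricC (SD Su Sw) Sv).
  (* The two halves, from v and from w, add up to b Q, which turns b (g(D_u v, w) + g(v, D_u w))
     into b chi rho_u(g(v, w)). *)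
  rewrite -{1}(af_chi fr m) /Q; by field.
Qed.

End AdaptedFrame.

(** * Existence of adapted frames *)

Section LocalFrame.
Variables (R : realType) (M : manifold R) (A : carrollian_lie_algebroid M).
Local Notation g := (@ca_metric R M A).
Local Notation L := (@ca_line R M A).
Local Notation Lat m := (@ca_line R M A m).
Local Notation S := (Sec A).
Local Notation r := (rank A).

Lemma exists_adapted_frame (m0 : M) : exists b chi e e' eps,
  @adapted_frame R M A b chi e e' eps /\ \forall m \near m0, b m = 1.
Proof.
have [[_ sub] _] := ca_lineP A; have [t [tm0 tS LE]] := sub m0.
have [c [K [sc c1 cK] [Kt c0]]] := smooth_bump (tdom_open t) tm0.
pose e a : section A := fun m => c m *: tframe t m (delta_mx 0 a).
pose eps a (u : section A) m := c m * tcoord t m (u m) 0 a.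
have Se a : S (e a) by exact: Sec_cutoff_frame sc cK Kt c0.
have seps a u : S u -> smooth (eps a u).
  move=> Su; apply: (smooth_cutoff openT (tdom_open t) sc cK Kt c0).
  by rewrite setTI; exact: smooth_tcoord.
pose chi m := c m * c m.
have schi : smooth chi by exact: (smooth_onM openT sc sc).
have decomp u m : \sum_a eps a u m *: e a m = chi m *: u m.
  have [Km|/c0 cm0] := pselect (K m); last first.
    rewrite /chi cm0 mul0r scale0r big1 // => a _.
    by rewrite /eps cm0 mul0r scale0r.
  have tm := Kt _ Km.
  rewrite -[in RHS](tcoordK tm (u m)) (tframeE _ tm) scaler_sumr; apply: eq_bigr => a _.
  by rewrite /eps /e /chi !scalerA; congr (_ *: _); ring.
have line_e (a : 'I_r) : (a < 1)%N -> forall m, Lat m (e a m).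
  move=> a1 m; have [Km|/c0 cm0] := pselect (K m); last first.
    by rewrite /e cm0 scale0r; exact: line0.
  have tm := Kt _ Km; apply: lineZ; rewrite LE //= => j j1.
  rewrite tframeK // mxE eqxx /=; case: eqP j1 => // ->.
  by rewrite leqNgt a1.
have line_eps (a : 'I_r) : (1 <= a)%N -> forall (u : section A) m,
    Lat m (u m) -> eps a u m = 0.
  move=> a1 u m; have [Km|/c0 cm0] := pselect (K m); last by rewrite /eps cm0 mul0r.
  by rewrite LE; [move=> /(_ a a1); rewrite /eps => ->; rewrite mulr0|exact: Kt].
(* On V the sections e form a genuine frame, so the Gram matrix controls g there. *)
pose V := interior [set m | c m = 1].
have oV : open V by exact: open_interior.
have Vc m : V m -> c m = 1 by move=> /interior_subset.
have Vt m : V m -> tdom t m.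
  move=> /Vc cm; have [/Kt//|/c0] := pselect (K m).
  by rewrite cm => /eqP; rewrite oner_eq0.
have gE u w m : S u -> S w -> V m -> g u w m = \sum_a eps a u m * g (e a) w m.
  move=> Su Sw Vm; rewrite -(metric_suml _ (f := fun a => eps a u)) //; last first.
    by move=> a; exact: seps.
  rewrite (_ : (fun p => _) = (fun p => chi p *: u p)); last first.
    by apply/functional_extensionality_dep => p; exact: decomp.
  by rewrite (tensorialZ (tensorial_metricl Sw)) // /chi Vc // !mul1r.
pose G m : 'M[R]_r := \matrix_(a, d) g (e a) (e d) m.
(* Row and column 0 of the Gram matrix vanish. A 1 in that corner makes it invertible without
   splitting off a block. *)
pose G' m : 'M[R]_r := G m + \matrix_(a, d) ((a == d) && (a < 1)%N)%:R.
have GL m (a d : 'I_r) : (d < 1)%N -> G m a d = 0.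
  move=> d1; rewrite mxE (@metric_SecLr _ _ _ (e a) (e d)) //.
  by split=> //; exact: line_e.
have G'unit m : V m -> G' m \in unitmx.
  move=> Vm; rewrite -row_free_unit -kermx_eq0; apply/rowV0P => x.
  move=> /sub_kermxP xG'.
  have xE d : \sum_a x 0 a * G m a d + x 0 d * (d < 1)%N%:R = 0.
    transitivity ((x *m G' m) 0 d); last by rewrite xG' mxE.
    rewrite /G' mulmxDr [RHS]mxE; congr (_ + _); first by rewrite mxE.
    rewrite [RHS]mxE (bigD1 d) //= mxE eqxx /= big1 ?addr0 // => a /negbTE ad.
    by rewrite mxE ad mulr0.
  have x0 (d : 'I_r) : (d < 1)%N -> x 0 d = 0.
    move=> d1; have := xE d; rewrite d1 mulr1 big1 ?add0r // => a _.
    by rewrite GL // mulr0.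
  (* A kernel vector x with x_0 = 0 gives u with u m in the kernel of g_m, that is in L_m; the
     coordinates of index at least 1 then vanish too. *)
  pose u : section A := fun p => \sum_a (fun=> x 0 a) p *: e a p.
  have Su : S u by apply: Sec_sum => a; apply: SecZ => //; exact: smooth_cst.
  have gu d : g u (e d) m = 0.
    rewrite metric_suml //; last first.
      by move=> a; exact: smooth_cst.
    have := xE d; have [d1|d1] := ltnP d 1.
      by move=> _; rewrite big1 // => a _; have := GL m a d d1; rewrite mxE => ->; rewrite mulr0.
    rewrite mulr0 addr0 => H; rewrite -[RHS]H; apply: eq_bigr => a _.
    by rewrite mxE.
  have guw w : S w -> g u w m = 0.
    move=> Sw; rewrite ca_metricC // gE // big1 // => a _.
    by rewrite ca_metricC // gu mulr0.
  have Lu : Lat m (u m).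
    (* The pointwise kernel tests every section through u m; by [gE], on V the metric depends only
       on that value. *)
    apply/(ca_ker_atE (c := A)) => u' w Su' Sw u'u.
    rewrite -[RHS](guw w Sw) !gE //; apply: eq_bigr => a _.
    by rewrite /eps u'u.
  apply/rowP => a; rewrite [RHS]mxE; have [/x0//|a1] := ltnP a 1.
  have := line_eps a a1 u m Lu; rewrite /eps Vc // mul1r => <-.
  rewrite /u linear_sum summxE (bigD1 a) //= big1 ?addr0.
    rewrite /e Vc // scale1r linearZ mxE tframeK ?mxE ?eqxx ?mulr1 //; exact: Vt.
  move=> d da; rewrite /e Vc // scale1r linearZ mxE tframeK; last exact: Vt.
  by rewrite mxE eqxx /= eq_sym (negbTE da) mulr0.
pose H m := invmx (G' m).
have sH d a : smooth_on V (fun m => H m d a).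
  apply: (smooth_on_invmx oV) => // i j.
  have s := smooth_onD oV (smooth_setT V (smooth_metric (Se i) (Se j)))
    (smooth_on_cst oV (((i == j) && (i < 1)%N)%:R : R)).
  by apply: (smooth_on_ext oV _ s) => m _; rewrite !mxE.
have HG m (d a : 'I_r) : V m -> (H m *m G m) d a = ((d == a) && (1 <= a)%N)%:R.
  move=> Vm; have HG' : H m *m G' m = 1%:M by rewrite mulVmx // G'unit.
  have [a1|a1] := ltnP a 1.
    by rewrite andbF mxE big1 // => i _; rewrite GL // mulr0.
  transitivity ((H m *m G' m) d a); last by rewrite HG' mxE andbT.
  rewrite /G' mulmxDr [RHS]mxE [X in _ = _ + X]mxE.
  rewrite [X in _ = _ + X]big1 ?addr0 // => i _.
  rewrite mxE; case: eqP => [->|]; last by rewrite mulr0.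
  by rewrite ltnNge a1 mulr0.
have Vm0 : V m0 by exact: c1.
(* A second bump inside V: it extends the inverse Gram matrix by zero and gives b chi = b. *)
have [b [K' [sb b1 cK'] [K'V b0]]] := smooth_bump oV Vm0.
pose e' d : section A := fun m => \sum_a (b m * H m d a) *: e a m.
have sbH d a : smooth (fun m => b m * H m d a).
  by apply: (smooth_cutoff openT oV sb cK' K'V b0); rewrite setTI.
exists b, chi, e, e', eps; split=> //; split=> //.
- move=> m; have [/K'V/Vc cm|/b0 ->] := pselect (K' m); last by rewrite mul0r.
  by rewrite /chi cm !mulr1.
- by move=> d; apply: Sec_sum => a; exact: SecZ.
- by move=> a f u v m; rewrite /eps linearP !mxE; ring.
- move=> d w m Sw; rewrite metric_suml //.
  have [Vm|/b0 bm] := pselect (K' m); last first.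
    by rewrite bm mul0r if_same big1 // => a _; rewrite !mul0r.
  have {}Vm := K'V _ Vm.
  have gE' a : g (e a) w m = \sum_i G m a i * eps i w m.
    rewrite ca_metricC // gE //; apply: eq_bigr => i _.
    by rewrite mulrC ca_metricC // mxE.
  transitivity (b m * \sum_i (H m *m G m) d i * eps i w m).
    rewrite mulr_sumr; under eq_bigr => a _ do rewrite gE' mulr_sumr.
    rewrite exchange_big; apply: eq_bigr => i _ /=.
    rewrite [in RHS]mxE mulr_suml mulr_sumr; apply: eq_bigr => a _; ring.
  rewrite (bigD1 d) //= HG // eqxx /= big1 ?addr0.
    by case: ifP; rewrite ?mul1r ?mul0r ?mulr0.
  by move=> i /negbTE di; rewrite HG // eq_sym di mul0r.
Qed.

End LocalFrame.

Theorem theorem2p52 (R : realType) (M : manifold R)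
    (A : carrollian_lie_algebroid M) :
  exists nabla : section A -> section A -> section A,
    carrollian_connection nabla.
Proof.
apply: local_to_global => m0.
have [b [chi [e [e' [eps [fr b1]]]]]] := exists_adapted_frame A m0.
exists b, (corrected_connection b chi e e' eps); split=> //.
exact: corrected_weighted.
Qed.
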